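(* Let $T>0$ and let $q$ be a polynomial in the $k$ real variables $x_1,\dots,x_k$, considered as a function of $N>k$ variables. Then $$\lim_{N\to\infty}\mathcal C^{N-1}_T\,q=\left(e^{-\frac T2 (r\partial_r)_k}\,e^{\frac{1-e^{-T}}2\Delta_{\mathbb R^k}}\,q\right)_{\mathbb C}=\mathbf B_T\,q .$$
   Context: Polynomials may have complex coefficients. $S^{N-1}(\sqrt N)=\{\mathbf x\in\mathbb R^N:\sum x_j^2=N\}$, with $\overline\sigma^{N-1}$ its normalized rotation-invariant measure and $\Delta_{S^{N-1}(\sqrt N)}$ its Laplace--Beltrami operator, and $Q^{N-1}(\sqrt N)=\{\mathbf a\in\mathbb C^N:\sum a_j^2=N\}$. For $f\in L^2(S^{N-1}(\sqrt N),\overline\sigma^{N-1})$, $\mathcal C^{N-1}_Tf$ is the holomorphic extension to $Q^{N-1}(\sqrt N)$ of $e^{\frac T2\Delta_{S^{N-1}(\sqrt N)}}f$ (the heat operator). For $N>k$, $\Delta_{S^{N-1}(\sqrt N)}$ maps the restriction to the sphere of a polynomial in $x_1,\dots,x_k$ to the restriction of a unique polynomial in $x_1,\dots,x_k$ of no larger degree, so it is viewed as a self-map of the space of polynomials in $x_1,\dots,x_k$. On such $q$ the heat operator is $\sum_n\frac1{n!}\left(\frac T2\Delta_{S^{N-1}(\sqrt N)}\right)^nq$, and so $\mathcal C^{N-1}_Tq$ is identified with a holomorphic polynomial in $a_1,\dots,a_k$ of degree at most $\deg q$. The limit is with respect to any norm on the finite-dimensional space of holomorphic polynomials in $a_1,\dots,a_k$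 of degree at most $\deg q$. For a polynomial $p$ in $x_1,\dots,x_k$, $p_{\mathbb C}$ is obtained by substituting $a_j$ for $x_j$. For real $\lambda$, $(e^{\lambda(r\partial_r)_k}f)(\mathbf x)=f(e^\lambda\mathbf x)$. For $t>0$, $e^{\frac t2\Delta_{\mathbb R^k}}$ is the heat operator, given on polynomials by $\sum_n\frac1{n!}\left(\frac t2\Delta_{\mathbb R^k}\right)^n$. With $\mathbf H=\sum_j\left(\frac{\partial^2}{\partial x_j^2}-x_j\frac{\partial}{\partial x_j}\right)$, $\mathbf B_Tq=\left(\sum_n\frac1{n!}\left(\frac T2\mathbf H\right)^nq\right)_{\mathbb C}$ for polynomials $q$. *)

(* Defs.v *)
(* The notations of multinomials clash with those of MathComp-Analysis, so they
   are left out: [mpoly k R[i]] is the type usually written {mpoly R[i][k]}, [meval v p] is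
   p.@[v], [mderiv i p] is p^`M(i), [mcoeff m p] is p@_m. *)
From HB Require Import structures.
From mathcomp Require Import all_boot all_order all_algebra complex.
From mathcomp Require Import -(notations) mpoly.
From mathcomp Require Import all_classical all_reals all_analysis.
Import Order.TTheory GRing.Theory Num.Theory numFieldNormedType.Exports.

Set Implicit Arguments.
Unset Strict Implicit.
Unset Printing Implicit Defensive.

Local Open Scope classical_set_scope.
Local Open Scope ring_scope.
Local Open Scope complex_scope.

Section Sphere.
Variables (R : realType) (N : nat).
Implicit Types x y : 'rV[R]_N.

(* The norm that the library puts on 'rV[R]_N is the sup norm. *)
Definition enorm x : R := Num.sqrt (\sum_(j < N) x 0 j ^+ 2).

(* S^{N-1}(sqrt N) *)
Definition sphere : set 'rV[R]_N :=
  [set x | \sum_(j < N) x 0 j ^+ 2 = N%:R].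

Definition sphere_proj y : 'rV[R]_N := (Num.sqrt N%:R / enorm y) *: y.

(* j-th partial derivative at a point of the sphere of the extension of f that
   is constant along rays; it depends only on the values of f on the sphere. *)
Definition sphere_partial (j : 'I_N) (f : 'rV[R]_N -> R) x : R :=
  'D_(delta_mx 0 j) (f \o sphere_proj) x.

(* The Riemannian gradient for the metric induced from R^N.  The extension of f
   is constant in the radial direction, so its gradient at a point of the sphere
   is tangent to the sphere and represents the differential of f there. *)
Definition sphere_grad (f : 'rV[R]_N -> R) x : 'rV[R]_N :=
  \row_(j < N) sphere_partial j f x.

(* The Riemannian divergence of a tangent vector field X, i.e. the trace of
   v |-> P (D_v X) on the tangent space at x, P being the orthogonal projection
   onto it: the differential of sphere_proj at x is P, so that this is also the
   trace on R^N of the differential of X \o sphere_proj. *)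
Definition sphere_div (X : 'rV[R]_N -> 'rV[R]_N) x : R :=
  \sum_(j < N) sphere_partial j (fun y => X y 0 j) x.

Definition laplace_beltrami (f : 'rV[R]_N -> R) : 'rV[R]_N -> R :=
  sphere_div (sphere_grad f).

Definition laplace_beltramiC (f : 'rV[R]_N -> R[i]) x : R[i] :=
  laplace_beltrami (fun y => complex.Re (f y)) x
    +i* laplace_beltrami (fun y => complex.Im (f y)) x.

End Sphere.

Section Polynomials.
Variables (R : realType) (k : nat).
Local Notation pol := (mpoly k R[i]).
Implicit Types (p q r : pol).

(* A polynomial in x_1, ..., x_k as a function on R^N; only N > k matters (if
   N <= k the missing coordinates are set to 0). *)
Definition pol_fun N p (x : 'rV[R]_N) : R[i] :=
  meval (fun i : 'I_k =>
    if insub (val i) is Some j then (x 0 j)%:C else 0) p.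

(* The Laplace-Beltrami operator of the sphere as a self-map of the polynomials
   in x_1, ..., x_k: for N > k, q is sent to the unique polynomial p such that
   the condition below holds. Recall that msize is the degree plus one, and is
   0 at the polynomial 0. *)
Definition sphere_lap N q : pol :=
  xget 0 [set p | (msize p <= msize q)%N /\
    forall x : 'rV[R]_N, sphere x ->
      laplace_beltramiC (pol_fun q) x = pol_fun p x].

(* sum_n A^n q / n!, the sum being taken coefficientwise.  The three operators
   used below do not raise the degree, so that this is convergence in a
   finite-dimensional space. *)
Definition op_exp (A : pol -> pol) q : pol :=
  xget 0 [set r | forall m,
    (fun n => Normc.normc
       (mcoeff m (\sum_(j < n) (j`!%:R)^-1 *: iter j A q) - mcoeff m r))
    @ \oo --> (0 : R)].

Definition lap q : pol := \sum_(j < k) mderiv j (mderiv j q).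

(* The operator H, written bold in the definition of B_T. *)
Definition hermite_op q : pol :=
  \sum_(j < k) (mderiv j (mderiv j q) - mpolyX R[i] (mnm1 j) * mderiv j q).

(* e^{(t/2) L} *)
Definition heat (L : pol -> pol) (t : R) q : pol :=
  op_exp (fun p => (t / 2)%:C *: L p) q.

(* e^{l (r d/dr)_k} *)
Definition dilation (l : R) q : pol :=
  comp_mpoly [tuple (expR l)%:C *: mpolyX R[i] (mnm1 j) | j < k] q.

(* p |-> p_C *)
Definition complexify p : ('I_k -> R[i]) -> R[i] := fun a => meval a p.

(* The holomorphic polynomials in a_1, ..., a_k of degree < d. *)
Definition holpoly (d : nat) : set (('I_k -> R[i]) -> R[i]) :=
  [set complexify p | p in [set p | (msize p <= d)%N]].

(* The transform C_T^{N-1} on polynomials: the holomorphic extension to the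
   quadric { a | sum_j a_j^2 = N } of the function on the sphere given by a
   polynomial r is the restriction of r_C, and is identified with r_C. *)
Definition CT (T : R) (N : nat) q : ('I_k -> R[i]) -> R[i] :=
  complexify (heat (sphere_lap N) T q).

Definition BT (T : R) q : ('I_k -> R[i]) -> R[i] :=
  complexify (heat hermite_op T q).

(* nu is a norm on the complex vector subspace V; its values outside V are
   irrelevant. *)
Definition is_norm_on (V : set (('I_k -> R[i]) -> R[i]))
    (nu : (('I_k -> R[i]) -> R[i]) -> R) : Prop :=
  [/\ forall F, V F -> 0 <= nu F,
      forall F, V F -> nu F = 0 -> F = 0,
      forall (c : R[i]) F, V F -> nu (c *: F) = Normc.normc c * nu F &
      forall F G, V F -> V G -> nu (F + G) <= nu F + nu G].

(* Convergence inside V with respect to every norm on V. *)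
Definition cvg_in (V : set (('I_k -> R[i]) -> R[i]))
    (F : nat -> ('I_k -> R[i]) -> R[i]) (L : ('I_k -> R[i]) -> R[i]) : Prop :=
  [/\ \forall N \near \oo, V (F N), V L &
      forall nu, is_norm_on V nu -> (fun N => nu (F N - L)) @ \oo --> (0 : R)].

End Polynomials.

(* Main.v *)
(* On the sphere of radius sqrt N, extending a polynomial p radially and
   differentiating gives, with E the Euler operator r d/dr,
     Delta_S p = Delta p - (N-2)/N E p - 1/N E^2 p
               = H p + 1/N (2 E - E^2) p,      H = Delta - E,
   and a polynomial in k < N variables is determined by its restriction to the
   sphere, since the sphere projects onto a ball of R^k.  On polynomials of
   bounded degree the exponential series depends continuously on the operator,
   so that e^{T/2 Delta_S} q tends to e^{T/2 H} q.  The identification of the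
   limit comes from [E, Delta] = - 2 Delta: it gives
     H e^{- Delta / 2} = - e^{- Delta / 2} E,
   hence e^{t H} = e^{- Delta / 2} e^{- t E} e^{Delta / 2}, and moving the
   dilation e^{- t E} to the left turns the Gaussian factors into
   e^{(1 - e^{- 2 t}) / 2 Delta}. *)
Require Import Defs.
From HB Require Import structures.
From mathcomp Require Import all_boot all_order all_algebra complex.
From mathcomp Require Import -(notations) mpoly.
From mathcomp Require Import all_classical all_reals all_analysis.
From mathcomp Require Import ring zify.
Import Order.TTheory GRing.Theory Num.Theory numFieldNormedType.Exports.
Local Open Scope classical_set_scope.
Local Open Scope ring_scope.

(** * The Euler operator and the Laplacian on polynomials: coefficients, commutators, degrees *)

Definition euler {n} {K : comNzRingType} (p : mpoly n K) : mpoly n K :=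
  \sum_(j < n) mpolyX K (mnm1 j) * mderiv j p.

Definition laplacian {n} {K : comNzRingType} (p : mpoly n K) : mpoly n K :=
  \sum_(j < n) mderiv j (mderiv j p).

Lemma mcoeff_X_deriv n (K : comNzRingType) (p : mpoly n K) j m :
  mcoeff m (mpolyX K (mnm1 j) * mderiv j p) = mcoeff m p *+ m j.
Proof.
rewrite [in LHS](mpolyE p) [in RHS](mpolyE p) !raddf_sum mulr_sumr raddf_sum -sumrMnl.
apply: eq_bigr => m' _ /=; rewrite mderivZ mderivX scalerA -scalerAr !mcoeffZ mcoeffX.
(* Subtraction of exponents is truncated: when [m' j = 0], multiplying by x_j does not restore the
   monomial [m'], and both sides have to be seen to vanish instead. *)
have [m'0|m'0] := posnP (m' j).
  rewrite m'0 mulr0 mul0r; case: eqP => [<-|_]; last by rewrite mulr0 mul0rn.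
  by rewrite m'0 mulr0n.
rewrite -mpolyXD mcoeffX addmC submK; last first.
  by rewrite lep1mP -lt0n.
case: eqP => [<-|_]; last by rewrite !mulr0 mul0rn.
by rewrite !mulr1 mulr_natr.
Qed.

Lemma mcoeff_euler n (K : comNzRingType) (p : mpoly n K) m :
  mcoeff m (euler p) = mcoeff m p *+ mdeg m.
Proof.
rewrite raddf_sum mdegE -sumrMnr; apply: eq_bigr => j _ /=.
exact: mcoeff_X_deriv.
Qed.

Lemma mcoeff_laplacian n (K : comNzRingType) (p : mpoly n K) m :
  mcoeff m (laplacian p) =
  \sum_(j < n) mcoeff (mnm_add (mnm_add m (mnm1 j)) (mnm1 j)) p *+ ((m j).+2 * (m j).+1).
Proof.
rewrite raddf_sum; apply: eq_bigr => j _ /=.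
by rewrite !mcoeff_deriv mnmDE mnm1E eqxx addn1 mulrnA.
Qed.

Lemma euler_is_linear n (K : comNzRingType) : linear (@euler n K).
Proof.
move=> c p q; apply/mpolyP => m.
by rewrite mcoeffD mcoeffZ !mcoeff_euler mcoeffD mcoeffZ mulrnDl mulrnAr.
Qed.

HB.instance Definition _ n (K : comNzRingType) :=
  GRing.isLinear.Build K (mpoly n K) (mpoly n K) _ (@euler n K) (@euler_is_linear n K).

Lemma laplacian_is_linear n (K : comNzRingType) : linear (@laplacian n K).
Proof.
move=> c p q; rewrite /laplacian scaler_sumr -big_split; apply: eq_bigr => j _ /=.
by rewrite !linearP.
Qed.

HB.instance Definition _ n (K : comNzRingType) :=
  GRing.isLinear.Build K (mpoly n K) (mpoly n K) _ (@laplacian n K)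
    (@laplacian_is_linear n K).

(** E multiplies a homogeneous polynomial by its degree and d_j lowers the degree by one, so
    [E, d_j] = - d_j; using this twice gives [E, Delta] = - 2 Delta. *)
Lemma euler_deriv n (K : comNzRingType) (p : mpoly n K) j :
  euler (mderiv j p) = mderiv j (euler p) - mderiv j p.
Proof.
apply/mpolyP => m; rewrite mcoeffB !(mcoeff_euler, mcoeff_deriv).
by rewrite mdegD mdeg1 addn1 (mulrSr _ (mdeg m)) (mulrnDl (m j).+1) addrK mulrnAC.
Qed.

Lemma euler_laplacian n (K : comNzRingType) (p : mpoly n K) :
  euler (laplacian p) = laplacian (euler p) - laplacian p *+ 2.
Proof.
rewrite /laplacian raddf_sum -sumrMnl -sumrB; apply: eq_bigr => j _ /=.
by rewrite !euler_deriv raddfB /= -addrA -opprD.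
Qed.

Lemma euler_iter_laplacian n (K : comNzRingType) (p : mpoly n K) j :
  euler (iter j laplacian p) =
  iter j laplacian (euler p) - iter j laplacian p *+ j.*2.
Proof.
elim: j => [|j IH] /=; first by rewrite mulr0n subr0.
rewrite euler_laplacian IH raddfB raddfMn /= -addrA -opprD -mulrnDr.
by rewrite doubleS addn2.
Qed.

(** Turns the degree bounds below into statements about single coefficients, for which the operators
    have explicit formulas. *)
Lemma msize_leP n (K : comNzRingType) (p : mpoly n K) d :
  reflect (forall m, (d <= mdeg m)%N -> mcoeff m p = 0) (msize p <= d)%N.
Proof.
apply: (iffP idP) => [le_pd m le_dm | H].
  by apply/eqP; rewrite mcoeff_eq0 msize_mdeg_ge // (leq_trans le_pd).
rewrite msizeE; apply/bigmax_leqP_seq => m + _; rewrite mcoeff_msupp ltnNge.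
by apply: contraNN => /H ->.
Qed.

(** Each Laplacian lowers the degree by at least one, so the exponential series of a multiple of the
    Laplacian is a finite sum on every polynomial. *)
Lemma iter_laplacian_eq0 n (K : comNzRingType) (p : mpoly n K) j :
  (msize p <= j)%N -> iter j laplacian p = 0.
Proof.
suff H : (msize (iter j laplacian p) <= msize p - j)%N.
  by rewrite -subn_eq0 => /eqP p0; apply/eqP; rewrite -msize_poly_eq0 -leqn0 -p0.
elim: j => [|j IH]; first by rewrite subn0.
apply/msize_leP => m; rewrite leq_subLR => le_pm.
rewrite mcoeff_laplacian big1 // => i _.
rewrite (msize_leP _ _ _ _ IH) ?mul0rn //.
by rewrite leq_subLR !mdegD !mdeg1 (leq_trans le_pm) // !addnA -[j.+1]addn1; lia.
Qed.

Lemma msize_laplacian n (K : comNzRingType) (p : mpoly n K) :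
  (msize (laplacian p) <= msize p)%N.
Proof.
apply/msize_leP => m le_pm; rewrite mcoeff_laplacian big1 // => i _.
rewrite (msize_leP _ _ _ _ (leqnn (msize p))) ?mul0rn // !mdegD -addnA.
by rewrite (leq_trans le_pm) ?leq_addr.
Qed.

Lemma msize_euler n (K : comNzRingType) (p : mpoly n K) :
  (msize (euler p) <= msize p)%N.
Proof.
apply/msize_leP => m le_pm.
by rewrite mcoeff_euler (msize_leP _ _ _ _ (leqnn (msize p))) ?mul0rn.
Qed.

(** * The modulus of complex numbers and limits taken through real and imaginary parts *)

Section ComplexModulus.
Variable R : realType.
Local Open Scope complex_scope.
Local Notation normc := (@Normc.normc R).
Implicit Types x y z : R[i].

Lemma normc_ge0 z : 0 <= normc z.
Proof. by case: z => a b; apply: sqrtr_ge0. Qed.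

Lemma ler_normcD x y : normc (x + y) <= normc x + normc y.
Proof. exact: (@le_normcD R). Qed.

Lemma normc_real (a : R) : normc a%:C = `|a|.
Proof. by rewrite /= expr0n /= addr0 sqrtr_sqr. Qed.

Lemma normc_nat m : normc m%:R = m%:R.
Proof. by rewrite -(rmorph_nat (real_complex R)) normc_real normr_nat. Qed.

Lemma ler_Re_normc z : `|complex.Re z| <= normc z.
Proof.
by case: z => a b /=; rewrite -sqrtr_sqr ler_wsqrtr // lerDl sqr_ge0.
Qed.

Lemma ler_Im_normc z : `|complex.Im z| <= normc z.
Proof.
by case: z => a b /=; rewrite -sqrtr_sqr ler_wsqrtr // lerDr sqr_ge0.
Qed.

Lemma ler_normc_Re_Im z : normc z <= `|complex.Re z| + `|complex.Im z|.
Proof.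
rewrite {1}[z]complexE (le_trans (ler_normcD _ _)) // Normc.normcM !normc_real.
by rewrite /= expr0n expr1n add0r sqrtr1 mul1r.
Qed.

Lemma cvg_Re_Im (u : nat -> R[i]) (a b : R) :
  (complex.Re (u n) @[n --> \oo] --> a) -> (complex.Im (u n) @[n --> \oo] --> b) ->
  normc (u n - (a +i* b)) @[n --> \oo] --> (0 : R).
Proof.
move=> cva cvb.
have cv0 : `|complex.Re (u n) - a| + `|complex.Im (u n) - b| @[n --> \oo] --> (0 : R).
  rewrite -[X in _ --> X]addr0 -[X in _ --> X + _](normr0 R) -[X in _ --> _ + X](normr0 R).
  rewrite -{1}(subrr a) -(subrr b).
  by apply: cvgD; apply: cvg_norm; apply: cvgB => //; apply: cvg_cst.
apply: (squeeze_cvgr _ (cvg_cst 0) cv0); near=> n.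
rewrite normc_ge0 (le_trans (ler_normc_Re_Im _)) //.
by case: (u n).
Unshelve. all: by end_near. Qed.

End ComplexModulus.

(** * Coefficientwise convergence and the coefficient norm in bounded degree *)

Section CoefficientwiseConvergence.
Variables (R : realType) (n : nat).
Local Notation pol := (mpoly n R[i]).
Local Notation normc := (@Normc.normc R).
Implicit Types (p q r : pol) (d : nat).

Definition pcvg (u : nat -> pol) r : Prop :=
  forall m, (fun j => normc (mcoeff m (u j) - mcoeff m r)) @ \oo --> (0 : R).

Definition expsum (A : pol -> pol) q (l : nat) : pol :=
  \sum_(j < l) (j`!%:R)^-1 *: iter j A q.

Lemma pcvg_unique u r1 r2 : pcvg u r1 -> pcvg u r2 -> r1 = r2.
Proof.
move=> cv1 cv2; apply/mpolyP => m; apply/eqP; rewrite -subr_eq0; apply/eqP.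
apply: Normc.eq0_normc; apply/eqP; rewrite eq_le normc_ge0 andbT.
have cv : normc (mcoeff m (u j) - mcoeff m r1) +
    normc (mcoeff m (u j) - mcoeff m r2) @[j --> \oo] --> (0 : R).
  by rewrite -[X in _ --> X]addr0; apply: cvgD.
apply: (ler_cvg_to (cvg_cst _) cv); near=> j.
rewrite [leRHS](_ : _ = normc (mcoeff m r1 - mcoeff m (u j)) +
  normc (mcoeff m (u j) - mcoeff m r2)); last first.
  by rewrite -[X in X + _]normcN opprB.
apply: le_trans (ler_normcD _ _ _).
by rewrite addrA subrK.
Unshelve. all: by end_near. Qed.

(** Coefficientwise limits are unique, so the choice made by [xget] is forced: exhibiting one limit
    of the partial sums computes the exponential. *)
Lemma op_exp_eq A q r : pcvg (expsum A q) r -> op_exp A q = r.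
Proof.
move=> cv; rewrite /op_exp; case: xgetP => [r' _ cv'|/(_ r)]; last by case.
exact: pcvg_unique cv' cv.
Qed.

(** The l^1 norm of the coefficients in degrees below [d]. It is a norm on the polynomials with
    [msize p <= d], and only a seminorm on all of them. *)
Definition cnorm d p : R := \sum_(m : bmultinom n d) normc (mcoeff m p).

Lemma cnorm_ge0 d p : 0 <= cnorm d p.
Proof. by apply: sumr_ge0 => m _; apply: normc_ge0. Qed.

Lemma normc_mcoeff_le d p m : (msize p <= d)%N -> normc (mcoeff m p) <= cnorm d p.
Proof.
move=> le_pd; have [lt_md|le_dm] := ltnP (mdeg m) d.
  rewrite /cnorm (bigD1 (BMultinom lt_md)) //= lerDl.
  by apply: sumr_ge0 => m' _; apply: normc_ge0.
by rewrite (msize_leP _ _ _ _ le_pd) // Normc.normc0 cnorm_ge0.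
Qed.

Lemma cnormD d p q : cnorm d (p + q) <= cnorm d p + cnorm d q.
Proof.
rewrite /cnorm -big_split /=; apply: ler_sum => m _.
by rewrite mcoeffD ler_normcD.
Qed.

Lemma cnormZ d c p : cnorm d (c *: p) = normc c * cnorm d p.
Proof.
by rewrite /cnorm mulr_sumr; apply: eq_bigr => m _; rewrite mcoeffZ Normc.normcM.
Qed.

Lemma cnorm_sum d (I : Type) (s : seq I) (P : pred I) (F : I -> pol) :
  cnorm d (\sum_(i <- s | P i) F i) <= \sum_(i <- s | P i) cnorm d (F i).
Proof.
elim/big_rec2: _ => [|i y z _ le_zy].
  by rewrite -(scale0r 0) cnormZ Normc.normc0 mul0r.
by rewrite (le_trans (cnormD _ _ _)) // lerD2l.
Qed.

Lemma linear_combination (A : pol -> pol) (I : Type) (s : seq I) (c : I -> R[i]) F :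
  linear A -> A (\sum_(i <- s) c i *: F i) = \sum_(i <- s) c i *: A (F i).
Proof.
move=> linA.
pose A' : {linear pol -> pol} := HB.pack A (GRing.isLinear.Build _ _ _ _ A linA).
rewrite -[A]/(A' : _ -> _) linear_sum.
by apply: eq_bigr => i _; rewrite linearZ.
Qed.

Lemma linear_monomialE (A : pol -> pol) d p : linear A -> (msize p <= d)%N ->
  A p = \sum_(m : bmultinom n d) mcoeff m p *: A (mpolyX R[i] m).
Proof.
by move=> linA le_pd; rewrite {1}(mpolywE le_pd) linear_combination.
Qed.

(** A linear map on a finite-dimensional space is bounded: the constant is the sum of the norms of
    the images of the monomials. *)
Lemma linear_cnorm_bound (A : pol -> pol) d : linear A ->
  exists2 C, 0 <= C & forall p, (msize p <= d)%N -> cnorm d (A p) <= C * cnorm d p.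
Proof.
move=> linA; exists (\sum_(m : bmultinom n d) cnorm d (A (mpolyX R[i] m))).
  by apply: sumr_ge0 => m _; apply: cnorm_ge0.
move=> p le_pd; rewrite (linear_monomialE _ _ _ linA le_pd).
rewrite (le_trans (cnorm_sum _ _ _ _ _)) // mulr_suml; apply: ler_sum => m _.
by rewrite cnormZ mulrC ler_wpM2l ?cnorm_ge0 // normc_mcoeff_le.
Qed.

(** In bounded degree only finitely many coefficients can be nonzero, so the two modes of
    convergence agree. *)
Lemma pcvg_cnorm u r d : (forall l, (msize (u l) <= d)%N) -> (msize r <= d)%N ->
  pcvg u r <-> cnorm d (u l - r) @[l --> \oo] --> (0 : R).
Proof.
move=> le_ud le_rd; split => [cv|cv m].
  rewrite (_ : 0 = \sum_(m : bmultinom n d) (0 : R)); last by rewrite big1.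
  apply: cvg_big => [|m _]; first exact: add_continuous.
  by under eq_fun do rewrite mcoeffB; apply: cv.
apply: (squeeze_cvgr _ (cvg_cst 0) cv); near=> l.
rewrite normc_ge0 -mcoeffB normc_mcoeff_le //.
apply/msize_leP => m' le_dm'.
by rewrite mcoeffB !(msize_leP _ _ _ d _ m' le_dm') ?subr0.
Unshelve. all: by end_near. Qed.

End CoefficientwiseConvergence.

(** * Convergence of the exponential series of an operator that does not raise the degree *)

Section OperatorExponential.
Variables (R : realType) (n : nat).
Local Notation pol := (mpoly n R[i]).
Local Notation normc := (@Normc.normc R).
Implicit Types (p q r : pol) (d : nat) (A B : pol -> pol).

Definition degree_nonincreasing A : Prop := forall p, (msize (A p) <= msize p)%N.

Lemma msize_iter A j p : degree_nonincreasing A -> (msize (iter j A p) <= msize p)%N.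
Proof. by move=> dA; elim: j => //= j IH; apply: leq_trans (dA _) IH. Qed.

Lemma msize_expsum A q l : degree_nonincreasing A -> (msize (expsum _ _ A q l) <= msize q)%N.
Proof.
move=> dA; apply/msize_leP => m le_qm; rewrite raddf_sum big1 // => j _ /=.
by rewrite mcoeffZ (msize_leP _ _ _ _ (msize_iter _ _ _ dA)) ?mulr0.
Qed.

Lemma cnorm_iter A d C q j : degree_nonincreasing A -> (msize q <= d)%N -> 0 <= C ->
  (forall p, (msize p <= d)%N -> cnorm _ _ d (A p) <= C * cnorm _ _ d p) ->
  cnorm _ _ d (iter j A q) <= C ^+ j * cnorm _ _ d q.
Proof.
move=> dA le_qd C0 HC; elim: j => [|j IH]; first by rewrite mul1r.
rewrite iterS (le_trans (HC _ _)) ?(leq_trans (msize_iter _ _ _ dA)) //.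
by rewrite exprS -mulrA ler_wpM2l.
Qed.

Lemma cvgn_series_exp_bound (u : nat -> R) C K : 0 <= C -> 0 <= K ->
  (forall j, `|u j| <= (j`!%:R)^-1 * (C ^+ j * K)) -> cvgn (series u).
Proof.
move=> C0 K0 Hu; apply: normed_cvg.
apply: (@series_le_cvg _ _ (fun j => K * exp_coeff C j)) => [j|j|j|].
- exact: normr_ge0.
- by rewrite mulr_ge0 // exp_coeff_ge0.
- by rewrite (le_trans (Hu j)) // [_^-1 * _]mulrC mulrAC mulrC.
- by apply: is_cvg_seriesZ; apply: is_cvg_series_exp_coeff.
Qed.

(** With C a bound for [A] in degrees below [d], each coefficient of the j-th term is at most C^j
    |q| / j!. The real and imaginary parts of every coefficient are thus dominated by a multiple of
    the series of e^C. *)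
Lemma expsum_cvg A q : linear A -> degree_nonincreasing A ->
  exists2 r, (msize r <= msize q)%N & pcvg _ _ (expsum _ _ A q) r.
Proof.
move=> linA dA; set d := msize q.
have [C C0 HC] := linear_cnorm_bound _ _ _ d linA.
have [L cvL] : exists L, forall m,
    normc (mcoeff m (expsum _ _ A q l) - L m) @[l --> \oo] --> (0 : R).
  pose z m j := (j`!%:R)^-1 * mcoeff m (iter j A q).
  have Hz m j : normc (z m j) <= (j`!%:R)^-1 * (C ^+ j * cnorm _ _ d q).
    rewrite /z Normc.normcM Normc.normcV normc_nat ler_wpM2l ?invr_ge0 //.
    apply: le_trans (cnorm_iter _ _ _ _ _ dA (leqnn _) C0 HC).
    by apply: normc_mcoeff_le; apply: msize_iter.
  have cvR m : cvgn (series (fun j => complex.Re (z m j))).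
    apply: (cvgn_series_exp_bound _ _ _ C0 (cnorm_ge0 _ _ d q)) => j.
    by rewrite (le_trans (ler_Re_normc _ _)).
  have cvI m : cvgn (series (fun j => complex.Im (z m j))).
    apply: (cvgn_series_exp_bound _ _ _ C0 (cnorm_ge0 _ _ d q)) => j.
    by rewrite (le_trans (ler_Im_normc _ _)).
  exists (fun m => limn (series (fun j => complex.Re (z m j))) +i*
                    limn (series (fun j => complex.Im (z m j))))%C => m.
  have E l : mcoeff m (expsum _ _ A q l) = \sum_(0 <= j < l) z m j.
    by rewrite big_mkord raddf_sum; apply: eq_bigr => j _ /=; rewrite mcoeffZ.
  apply: cvg_Re_Im.
    under eq_fun => l do rewrite E (raddf_sum (@complex.Re R : Rcomplex R -> R)).
    exact: cvR.
  under eq_fun => l do rewrite E (raddf_sum (@complex.Im R : Rcomplex R -> R)).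
  exact: cvI.
(* The limits [L m] are assembled into a polynomial from the degrees below [d] only; all partial
   sums have zero coefficients in the other degrees. *)
pose r : pol := \sum_(m : bmultinom n d) L m *: mpolyX R[i] m.
have rE m : mcoeff m r = if (mdeg m < d)%N then L m else 0.
  rewrite raddf_sum; have [lt_md|le_dm] := ltnP.
    rewrite (bigD1 (BMultinom lt_md)) //= mcoeffZ mcoeffX eqxx mulr1 big1 ?addr0 //.
    move=> m' ne_m'; rewrite mcoeffZ mcoeffX; case: eqP => [e|_]; last exact: mulr0.
    by case/eqP: ne_m'; apply: val_inj.
  rewrite big1 // => m' _ /=; rewrite mcoeffZ mcoeffX; case: eqP => [e|_]; last exact: mulr0.
  by move: (bmdeg m'); rewrite ltnNge e le_dm.
exists r.
  by apply/msize_leP => m le_dm; rewrite rE ltnNge le_dm.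
move=> m; rewrite rE; case: ltnP => [_|le_dm]; first exact: cvL.
under eq_fun => l do
  rewrite (msize_leP _ _ _ _ (msize_expsum _ _ _ dA) _ le_dm) subr0 Normc.normc0.
exact: cvg_cst.
Qed.

Lemma op_expP A q : linear A -> degree_nonincreasing A ->
  pcvg _ _ (expsum _ _ A q) (op_exp A q) /\ (msize (op_exp A q) <= msize q)%N.
Proof.
move=> linA dA; have [r le_r cv] := expsum_cvg _ q linA dA.
by rewrite (op_exp_eq _ _ _ _ _ cv).
Qed.

End OperatorExponential.

(** * Continuity of the exponential under a perturbation of order 1/N *)

Section Perturbation.
Variables (R : realType) (n : nat).
Local Notation pol := (mpoly n R[i]).
Local Notation normc := (@Normc.normc R).
Implicit Types (p q r : pol) (d : nat) (A B : pol -> pol).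

Lemma linear_add A p q : linear A -> A (p + q) = A p + A q.
Proof. by move=> linA; rewrite -[p]scale1r linA !scale1r. Qed.

Lemma linear_sub A p q : linear A -> A (p - q) = A p - A q.
Proof. by move=> linA; rewrite [p - q]addrC -[- q]scaleN1r linA scaleN1r addrC. Qed.

Lemma linear_scale A c p : linear A -> A (c *: p) = c *: A p.
Proof.
move=> linA; have A0 : A 0 = 0 by rewrite -{1}(subrr 0) linear_sub // subrr.
by rewrite -[c *: p]addr0 linA A0 addr0.
Qed.

Lemma degree_nonincreasing_add A B (c : R[i]) :
  degree_nonincreasing _ _ A -> degree_nonincreasing _ _ B ->
  degree_nonincreasing _ _ (fun p => A p + c *: B p).
Proof.
move=> dA dB p; apply/msize_leP => m le_pm.
by rewrite mcoeffD mcoeffZ (msize_leP _ _ _ _ (dA p)) // (msize_leP _ _ _ _ (dB p)) //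
  mulr0 addr0.
Qed.

Lemma linear_add_scale A B (c : R[i]) : linear A -> linear B ->
  linear (fun p => A p + c *: B p).
Proof.
move=> linA linB a p q; rewrite linA linB !scalerDr !scalerA [c * a]mulrC.
by rewrite !addrA; congr (_ + _); rewrite -!addrA; congr (_ + _); rewrite addrC.
Qed.

Lemma linear_scale_op A (c : R[i]) : linear A -> linear (fun p => c *: A p).
Proof. by move=> linA a p q; rewrite linA scalerDr !scalerA [c * a]mulrC. Qed.

Lemma degree_nonincreasing_scale A (c : R[i]) :
  degree_nonincreasing _ _ A -> degree_nonincreasing _ _ (fun p => c *: A p).
Proof.
move=> dA p; apply/msize_leP => m le_pm.
by rewrite mcoeffZ (msize_leP _ _ _ _ (dA p)) ?mulr0.
Qed.

Section Bound.
Variables (A B : pol -> pol) (d : nat) (c : R).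
Hypotheses (linA : linear A) (linB : linear B).
Hypotheses (dA : degree_nonincreasing _ _ A) (dB : degree_nonincreasing _ _ B).
Hypothesis c_ge0 : 0 <= c.
Hypothesis bound : forall p, (msize p <= d)%N ->
  cnorm _ _ d (A p) + cnorm _ _ d (B p) <= c * cnorm _ _ d p.

Local Notation AN N := (fun p => A p + (N%:R)^-1 *: B p).

(** Since 1/N is at most 1, the joint bound for [A] and [B] controls A + B/N uniformly in [N]. *)
Lemma cnorm_perturbed N p : (0 < N)%N -> (msize p <= d)%N ->
  cnorm _ _ d (AN N p) <= c * cnorm _ _ d p.
Proof.
move=> N0 le_pd; apply: le_trans (bound _ le_pd).
rewrite (le_trans (cnormD _ _ _ _ _)) // lerD2l cnormZ Normc.normcV normc_nat.
by rewrite ler_piMl ?cnorm_ge0 // invf_le1 ?ltr0n // ler1n.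
Qed.

(** Telescoping: with A_N = A + B/N, A_N^(j+1) - A^(j+1) = A_N (A_N^j - A^j) + (1/N) B A^j. The base
    2c, in place of c, absorbs the number of terms that accumulate. *)
Lemma cnorm_iter_perturbed N q j : (0 < N)%N -> (msize q <= d)%N ->
  cnorm _ _ d (iter j (AN N) q - iter j A q) <=
  N%:R^-1 * ((2 * c) ^+ j * cnorm _ _ d q).
Proof.
move=> N0 le_qd.
have dAN := degree_nonincreasing_add _ _ (N%:R^-1) dA dB.
have linAN := linear_add_scale _ _ (N%:R^-1) linA linB.
elim: j => [|j IH].
  rewrite subrr -(scale0r 0) cnormZ Normc.normc0 mul0r.
  by rewrite mulr_ge0 ?invr_ge0 // mul1r cnorm_ge0.
set D := iter j (AN N) q - iter j A q.
have le_D : (msize D <= d)%N.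
  apply/msize_leP => m le_dm; rewrite mcoeffB.
  rewrite (msize_leP _ _ _ _ (leq_trans (msize_iter _ _ _ _ _ dAN) le_qd)) //.
  by rewrite (msize_leP _ _ _ _ (leq_trans (msize_iter _ _ _ _ _ dA) le_qd)) // subr0.
have le_B p : (msize p <= d)%N -> cnorm _ _ d (B p) <= c * cnorm _ _ d p.
  by move=> le_pd; apply: le_trans (bound _ le_pd); rewrite lerDr cnorm_ge0.
have le_A p : (msize p <= d)%N -> cnorm _ _ d (A p) <= c * cnorm _ _ d p.
  by move=> le_pd; apply: le_trans (bound _ le_pd); rewrite lerDl cnorm_ge0.
have -> : iter j.+1 (AN N) q - iter j.+1 A q =
    AN N D + N%:R^-1 *: B (iter j A q).
  by rewrite (linear_sub _ _ _ linAN) !iterS opprD addrA subrK.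
rewrite (le_trans (cnormD _ _ _ _ _)) // cnormZ Normc.normcV normc_nat.
(* The doubling in 2c splits the bound into two equal halves, one for each term of the telescoping
   identity. *)
have -> : N%:R^-1 * ((2 * c) ^+ j.+1 * cnorm R n d q) =
   c * (N%:R^-1 * ((2 * c) ^+ j * cnorm R n d q)) +
   N%:R^-1 * (c * ((2 * c) ^+ j * cnorm R n d q)).
  by rewrite exprS; ring.
apply: lerD.
  by rewrite (le_trans (cnorm_perturbed _ _ N0 le_D)) // ler_wpM2l.
rewrite ler_wpM2l ?invr_ge0 // (le_trans (le_B _ _)) //.
  exact: leq_trans (msize_iter _ _ _ _ _ dA) le_qd.
rewrite ler_wpM2l // (le_trans (cnorm_iter _ _ _ _ _ _ _ dA le_qd c_ge0 le_A)) //.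
by rewrite ler_wpM2r ?cnorm_ge0 // lerXn2r ?nnegrE ?mulr_ge0 // ler_peMl // ler1n.
Qed.

(** Weighting the previous bounds by 1/j! gives partial sums of the series of e^(2c), which stay
    below its limit. The bound does not depend on [l], so it survives the passage to the
    exponentials. *)
Lemma cnorm_expsum_perturbed N q l : (0 < N)%N -> (msize q <= d)%N ->
  cnorm _ _ d (expsum _ _ (AN N) q l - expsum _ _ A q l) <=
  N%:R^-1 * (limn (series (exp_coeff (2 * c))) * cnorm _ _ d q).
Proof.
move=> N0 le_qd; rewrite /expsum -sumrB.
under eq_bigr do rewrite -scalerBr.
rewrite (le_trans (cnorm_sum _ _ _ _ _ _ _)) //.
apply: (@le_trans _ _ (N%:R^-1 * (series (exp_coeff (2 * c)) l * cnorm _ _ d q))).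
  rewrite /series /= big_mkord mulr_suml mulr_sumr; apply: ler_sum => j _.
  rewrite cnormZ Normc.normcV normc_nat /exp_coeff /=.
  rewrite [leRHS](_ : _ = (j`!%:R)^-1 * (N%:R^-1 * ((2 * c) ^+ j * cnorm R n d q)));
    last by ring.
  by rewrite ler_wpM2l ?invr_ge0 ?cnorm_iter_perturbed.
rewrite ler_wpM2l ?invr_ge0 // ler_wpM2r ?cnorm_ge0 //.
apply: nondecreasing_cvgn_le; last exact: is_cvg_series_exp_coeff.
apply/nondecreasing_seqP => j; rewrite seriesSr lerDl.
by rewrite exp_coeff_ge0 // mulr_ge0.
Qed.

End Bound.

Lemma op_exp_perturbed_cvg (A_ : nat -> pol -> pol) A B q :
  linear A -> linear B ->
  degree_nonincreasing _ _ A -> degree_nonincreasing _ _ B ->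
  (\forall N \near \oo, A_ N =1 (fun p => A p + (N%:R)^-1 *: B p)) ->
  pcvg _ _ (fun N => op_exp (A_ N) q) (op_exp A q).
Proof.
move=> linA linB dA dB AE m; set d := msize q.
have [a a0 Ha] := linear_cnorm_bound _ _ _ d linA.
have [b b0 Hb] := linear_cnorm_bound _ _ _ d linB.
pose c := a + b; have c0 : 0 <= c by apply: addr_ge0.
have bound p : (msize p <= d)%N ->
    cnorm _ _ d (A p) + cnorm _ _ d (B p) <= c * cnorm _ _ d p.
  by move=> le_pd; rewrite mulrDl lerD ?Ha ?Hb.
pose K := limn (series (exp_coeff (2 * c))) * cnorm _ _ d q.
have cv0 : N%:R^-1 * K @[N --> \oo] --> (0 : R).
  rewrite -[X in _ --> X](mul0r K); apply: cvgMl.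
  by rewrite -cvg_shiftS; apply: cvg_harmonic.
apply: (squeeze_cvgr _ (cvg_cst 0) cv0); near=> N.
have N0 : (0 < N)%N by near: N; exists 1%N.
rewrite normc_ge0 /= (_ : A_ N = fun p => A p + N%:R^-1 *: B p); last first.
  by apply/funext; near: N.
have dAN := degree_nonincreasing_add _ _ (N%:R^-1) dA dB.
have linAN := linear_add_scale _ _ (N%:R^-1) linA linB.
have [cvN leN] := op_expP _ _ _ q linAN dAN.
have [cvA leA] := op_expP _ _ _ q linA dA.
have le_l l : normc (mcoeff m (expsum _ _ (fun p => A p + N%:R^-1 *: B p) q l) -
    mcoeff m (expsum _ _ A q l)) <= N%:R^-1 * K.
  apply: le_trans (cnorm_expsum_perturbed _ _ d c linA linB dA dB c0 bound _ _ l N0 (leqnn _)).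
  rewrite -mcoeffB; apply: normc_mcoeff_le; apply/msize_leP => m' le_dm'; rewrite mcoeffB.
  rewrite (msize_leP _ _ _ _ (msize_expsum _ _ _ _ _ dAN)) //.
  by rewrite (msize_leP _ _ _ _ (msize_expsum _ _ _ _ _ dA)) // subr0.
move: le_l (cvN m) (cvA m); move: (op_exp _ q) (op_exp A q) => rN rA.
move: (expsum _ _ _ q) (expsum _ _ A q) => sN sA le_l {}cvN {}cvA.
(* The two exponentials are compared through their partial sums of the same length [l]: the outer
   differences tend to 0 with [l] and the middle one is at most K/N. *)
have cv : normc (mcoeff m (sN l) - mcoeff m rN) + N%:R^-1 * K +
    normc (mcoeff m (sA l) - mcoeff m rA) @[l --> \oo] --> N%:R^-1 * K.
  rewrite -[X in _ --> X]addr0; apply: cvgD; last exact: cvA.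
  by rewrite -[X in _ --> X]add0r; apply: cvgD; [exact: cvN|exact: cvg_cst].
apply: (ler_cvg_to (cvg_cst _) cv); near=> l.
rewrite -[mcoeff m rN - _](subrKA (mcoeff m (sN l))).
rewrite -[mcoeff m (sN l) - mcoeff m rA](subrKA (mcoeff m (sA l))).
rewrite addrA (le_trans (ler_normcD _ _ _)) // lerD2r.
rewrite (le_trans (ler_normcD _ _ _)) //; apply: lerD; last exact: le_l.
by rewrite -normcN opprB.
Unshelve. all: by end_near. Qed.

End Perturbation.

(** * The flat heat operator, dilations and the Hermite semigroup *)

Section FlatHeat.
Variables (R : realType) (n : nat).
Local Open Scope complex_scope.
Local Notation pol := (mpoly n R[i]).
Local Notation normc := (@Normc.normc R).
Implicit Types (p q r : pol) (d : nat) (c : R[i]).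

Lemma iter_scale (A : pol -> pol) c j p : linear A ->
  iter j (fun p => c *: A p) p = c ^+ j *: iter j A p.
Proof.
move=> linA; elim: j => [|j IH]; first by rewrite scale1r.
by rewrite !iterS IH linear_scale // scalerA exprS.
Qed.

Lemma iter_linear (A : pol -> pol) j : linear A -> linear (iter j A).
Proof. by move=> linA; elim: j => [|j IH] c p q //=; rewrite IH linA. Qed.

(* [e^{c Delta}] on the polynomials of degree less than [d]; the series stops
   there because the Laplacian lowers the degree. *)
Definition gauss d c p : pol :=
  \sum_(j < d) (c ^+ j / j`!%:R) *: iter j laplacian p.

Lemma gauss_is_linear d c : linear (gauss d c).
Proof.
move=> a p q; rewrite /gauss scaler_sumr -big_split; apply: eq_bigr => j _ /=.
by rewrite iter_linear; [rewrite scalerDr !scalerA mulrC|exact: linearP].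
Qed.

(** The partial sums are constant from index [d] on. *)
Lemma op_exp_laplacian d c q : (msize q <= d)%N ->
  op_exp (fun p => c *: laplacian p) q = gauss d c q.
Proof.
move=> le_qd; apply: op_exp_eq => m.
apply: cvg_near_cst; exists d => // l /= le_dl.
have -> : expsum _ _ (fun p => c *: laplacian p) q l = gauss d c q.
  rewrite /expsum /gauss.
  rewrite -(big_mkord xpredT (fun j => j`!%:R^-1 *: iter j (fun p => c *: laplacian p) q)).
  rewrite -(big_mkord xpredT (fun j => (c ^+ j / j`!%:R) *: iter j laplacian q)).
  rewrite (@big_cat_nat _ _ _ d) //= [X in _ + X]big_nat_cond.
  rewrite [X in _ + X]big1 ?addr0 => [|j /andP[/andP[le_dj _] _]].
    apply: eq_bigr => j _; rewrite iter_scale; last exact: linearP.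
    by rewrite scalerA mulrC.
  rewrite iter_scale; last exact: linearP.
  by rewrite iter_laplacian_eq0 ?scaler0 // (leq_trans le_qd).
by rewrite subrr Normc.normc0.
Qed.

Lemma msize_gauss d c p : (msize (gauss d c p) <= msize p)%N.
Proof.
apply/msize_leP => m le_pm; rewrite raddf_sum big1 // => j _ /=.
have le_jp : (msize (iter j laplacian p) <= msize p)%N.
  by apply: msize_iter => p'; apply: msize_laplacian.
by rewrite mcoeffZ (msize_leP _ _ _ _ le_jp) ?mulr0.
Qed.

Lemma expr_sum_fact a b l :
  \sum_(i < l.+1) (a ^+ (l - i) / (l - i)`!%:R) * (b ^+ i / i`!%:R) =
  (a + b) ^+ l / l`!%:R :> R[i].
Proof.
rewrite exprDn mulr_suml; apply: eq_bigr => -[i /=]; rewrite ltnS => le_il _.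
have f0 j : j`!%:R != 0 :> R[i] by rewrite pnatr_eq0 -lt0n fact_gt0.
rewrite -[_ *+ 'C(l, i)]mulr_natr; have := f0 l; rewrite -(bin_fact le_il) !natrM.
move: (a ^+ _) (b ^+ _) (f0 i) (f0 (l - i)%N) => x y.
move: (i`!%:R) ((l - i)`!%:R) ('C(l, i)%:R) => u v w u0 v0.
rewrite !mulf_eq0 !negb_or => /and3P[w0 _ _].
by field; rewrite w0 u0 v0.
Qed.

(** The Cauchy product on a square of indices, regrouped by l = j + i: antidiagonals with l < d lie
    wholly inside the square, the truncated ones have l >= d and contribute nothing. *)
Lemma sum_antidiagonals d (F : nat -> nat -> R[i]) (G : nat -> pol) :
  (forall l, (d <= l)%N -> G l = 0) ->
  \sum_(j < d) \sum_(i < d) F j i *: G (j + i)%N =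
  \sum_(l < d) (\sum_(i < l.+1) F (l - i)%N i) *: G l.
Proof.
move=> G0; transitivity (\sum_(i < d) \sum_(l < d | (i <= l)%N) F (l - i)%N i *: G l).
  rewrite exchange_big; apply: eq_bigr => i _ /=.
  rewrite -(big_geq_mkord i d xpredT (fun l => F (l - i)%N i *: G l)).
  rewrite -(big_mkord xpredT (fun j => F j i *: G (j + i)%N)).
  transitivity (\sum_(0 + i <= l < d + i) F (l - i)%N i *: G l).
    by rewrite big_addn addnK; apply: eq_bigr => j _; rewrite addnK.
  rewrite add0n (@big_cat_nat _ _ _ d i (d + i)) ?leq_addr //=; last exact: ltnW.
  rewrite [X in _ + X]big_nat_cond [X in _ + X]big1 ?addr0 //.
  by move=> l /andP[/andP[le_dl _] _]; rewrite G0 // scaler0.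
rewrite (exchange_big_dep xpredT) //=; apply: eq_bigr => l _.
by rewrite scaler_suml (big_ord_widen d (fun i => F (l - i)%N i *: G l)).
Qed.

(** Multiplying the two series and summing each antidiagonal by the binomial theorem; truncation at
    [d] is harmless because the omitted powers of the Laplacian kill [q]. *)
Lemma gaussD d a b q : (msize q <= d)%N ->
  gauss d a (gauss d b q) = gauss d (a + b) q.
Proof.
move=> le_qd; rewrite {1}/gauss.
transitivity (\sum_(j < d) \sum_(i < d)
    ((a ^+ j / j`!%:R) * (b ^+ i / i`!%:R)) *: iter (j + i) laplacian q).
  apply: eq_bigr => j _.
  have linj := iter_linear _ j (laplacian_is_linear n R[i]).
  rewrite /gauss (linear_combination _ _ _ _ _ _ _ linj).
  by rewrite scaler_sumr; apply: eq_bigr => i _; rewrite scalerA iterD.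
rewrite (sum_antidiagonals d (fun j i => (a ^+ j / j`!%:R) * (b ^+ i / i`!%:R))
   (fun l => iter l laplacian q)).
  by apply: eq_bigr => l _; rewrite expr_sum_fact.
by move=> l le_dl; rewrite iter_laplacian_eq0 // (leq_trans le_qd).
Qed.

(** From E Delta^j = Delta^j E - 2j Delta^j: as 2j c^j / j! = 2c c^(j-1) / (j-1)!, the corrections
    sum up to 2c Delta e^(c Delta). *)
Lemma euler_gauss d c p : (msize p <= d)%N ->
  euler (gauss d c p) = gauss d c (euler p) - (c *+ 2) *: laplacian (gauss d c p).
Proof.
move=> le_pd; rewrite {1 2}/gauss raddf_sum /=.
under eq_bigr do rewrite linearZ /= euler_iter_laplacian scalerBr.
rewrite sumrB; congr (_ - _).
case: d le_pd => [|d] le_pd; first by rewrite /gauss !big_ord0 raddf0 scaler0.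
(* The last term dies under one more Laplacian; this matches the other sum, whose term of index 0
   carries the factor 0. *)
have -> : laplacian (gauss d.+1 c p) =
    \sum_(j < d) (c ^+ j / j`!%:R) *: iter j.+1 laplacian p.
  rewrite /gauss raddf_sum big_ord_recr /= [X in _ + X]linearZ /=.
  rewrite -iterS iter_laplacian_eq0 // scaler0 addr0.
  by apply: eq_bigr => j _; rewrite linearZ.
rewrite big_ord_recl mulr0n scaler0 add0r scaler_sumr; apply: eq_bigr => j _.
rewrite scalerA lift0 -[_ *+ j.+1.*2]scaler_nat scalerA; congr (_ *: _).
have f0 : j`!%:R != 0 :> R[i] by rewrite pnatr_eq0 -lt0n fact_gt0.
have j0 : j.+1%:R != 0 :> R[i] by rewrite pnatr_eq0.
rewrite factS natrM exprS -muln2 natrM.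
by field; rewrite f0 nat1r j0.
Qed.

Lemma hermite_opE p : hermite_op p = laplacian p - euler p.
Proof. by rewrite /hermite_op sumrB. Qed.

Lemma hermite_op_is_linear : linear (@hermite_op R n).
Proof.
move=> a p q; rewrite !hermite_opE euler_is_linear laplacian_is_linear scalerBr.
by rewrite opprD !addrA; congr (_ - _); rewrite addrAC.
Qed.

Lemma msize_hermite_op p : (msize (hermite_op p) <= msize p)%N.
Proof.
apply/msize_leP => m le_pm; rewrite hermite_opE mcoeffB.
by rewrite (msize_leP _ _ _ _ (msize_laplacian _ _ p)) //
  (msize_leP _ _ _ _ (msize_euler _ _ p)) // subr0.
Qed.

(* [gauss d (- 2^-1)] conjugates the Hermite operator to minus the Euler
   operator, which is diagonal on monomials. *)
Lemma hermite_op_gauss d p : (msize p <= d)%N ->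
  hermite_op (gauss d (- 2^-1) p) = gauss d (- 2^-1) (- euler p).
Proof.
move=> le_pd; rewrite hermite_opE euler_gauss // -[- euler p]scaleN1r.
rewrite (linear_scale _ _ _ _ _ (gauss_is_linear _ _)) scaleN1r.
rewrite (_ : - 2^-1 *+ 2 = -1 :> R[i]); last by field.
by rewrite scaleN1r opprK opprD addrC subrK.
Qed.

Lemma mcoeff_dilation (l : R) p m :
  mcoeff m (dilation l p) = (expR l)%:C ^+ mdeg m * mcoeff m p.
Proof.
rewrite /dilation comp_mpolyEX [in RHS](mpolyE p) !raddf_sum mulr_sumr.
apply: eq_bigr => m' _ /=; rewrite !mcoeffZ mcoeffX comp_mpolyX.
under eq_bigr => i _ do rewrite tnth_mktuple exprZn.
rewrite scaler_prod -mpolyXE_id prodrXr -mdegE mcoeffZ mcoeffX.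
by case: eqP => [->|_]; rewrite ?mulr0 // !mulr1 mulrC.
Qed.

Lemma msize_dilation (l : R) p : (msize (dilation l p) <= msize p)%N.
Proof.
apply/msize_leP => m le_pm.
by rewrite mcoeff_dilation (msize_leP _ _ _ _ (leqnn (msize p))) ?mulr0.
Qed.

Lemma laplacian_dilation (l : R) p :
  laplacian (dilation l p) = (expR l)%:C ^+ 2 *: dilation l (laplacian p).
Proof.
apply/mpolyP => m; rewrite mcoeff_laplacian [RHS]mcoeffZ mcoeff_dilation mcoeff_laplacian.
rewrite !mulr_sumr.
apply: eq_bigr => j _; rewrite mcoeff_dilation !mdegD !mdeg1 -addnA exprD.
by rewrite [RHS]mulrA [_ ^+ 2 * _]mulrC -mulrnAr.
Qed.

Lemma dilation_linear (l : R) : linear (dilation l : pol -> pol).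
Proof.
move=> a p q; apply/mpolyP => m.
rewrite [LHS]mcoeff_dilation [RHS]mcoeffD [in RHS]mcoeffZ.
by rewrite [X in _ = _ * X + _]mcoeff_dilation [X in _ = _ + X]mcoeff_dilation
  mcoeffD mcoeffZ mulrDr mulrCA.
Qed.

(** The Laplacian is homogeneous of order two, so each of its powers picks up a factor e^(2l) when
    it passes the dilation; in the exponential this rescales the time. *)
Lemma gauss_dilation d c (l : R) p :
  gauss d c (dilation l p) = dilation l (gauss d (c * (expR l)%:C ^+ 2) p).
Proof.
have iterE j : iter j laplacian (dilation l p) =
    ((expR l)%:C ^+ 2) ^+ j *: dilation l (iter j laplacian p).
  elim: j => [|j IH]; first by rewrite scale1r.
  rewrite !iterS IH (linear_scale _ _ _ _ _ (laplacian_is_linear _ _)).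
  rewrite laplacian_dilation scalerA (exprSr ((expR l)%:C ^+ 2) j).
  reflexivity.
rewrite /gauss (linear_combination _ _ _ _ _ _ _ (dilation_linear l)).
apply: eq_bigr => j _; rewrite iterE scalerA.
rewrite [(c * _) ^+ j]exprMn mulrAC.
reflexivity.
Qed.

Lemma cvg_expsum_exp (x : R) :
  \sum_(j < l) (j`!%:R)^-1 * x ^+ j @[l --> \oo] --> expR x.
Proof.
have cv : series (exp_coeff x) @ \oo --> expR x.
  exact: is_cvg_series_exp_coeff.
apply: cvg_trans cv; apply: near_eq_cvg; near=> l.
rewrite /series /= big_mkord; apply: eq_bigr => j _.
by rewrite /exp_coeff /= mulrC.
Unshelve. all: by end_near. Qed.

(** E is diagonal on monomials, so the coefficient at [m] sees the scalar exponential series at - t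
    |m|, and e^(- t |m|) is the factor by which the dilation acts there. *)
Lemma pcvg_expsum_euler (t : R) p :
  pcvg _ _ (expsum _ _ (fun p => - (t%:C *: euler p)) p) (dilation (- t) p).
Proof.
move=> m; set x := - (t * (mdeg m)%:R).
have iterE j : mcoeff m (iter j (fun p => - (t%:C *: euler p)) p) =
    (x ^+ j)%:C * mcoeff m p.
  elim: j => [|j IH]; first by rewrite expr0 mul1r.
  rewrite iterS mcoeffN mcoeffZ mcoeff_euler IH exprS.
  by rewrite !rmorphM rmorphN rmorphM rmorph_nat -mulr_natr; ring.
have sumE l : mcoeff m (expsum _ _ (fun p => - (t%:C *: euler p)) p l) =
    (\sum_(j < l) (j`!%:R)^-1 * x ^+ j)%:C * mcoeff m p.
  rewrite raddf_sum rmorph_sum mulr_suml; apply: eq_bigr => j _ /=.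
  by rewrite mcoeffZ iterE rmorphM fmorphV rmorph_nat mulrA.
have -> : mcoeff m (dilation (- t) p) = (expR x)%:C * mcoeff m p.
  by rewrite mcoeff_dilation -rmorphXn -expRM_natr mulNr.
have cv0 : `|\sum_(j < l) (j`!%:R)^-1 * x ^+ j - expR x| * normc (mcoeff m p)
    @[l --> \oo] --> (0 : R).
  rewrite -[X in _ --> X](mul0r (normc (mcoeff m p))); apply: cvgMl.
  by apply/norm_cvg0P/subr_cvg0; apply: cvg_expsum_exp.
apply: cvg_trans cv0; apply: near_eq_cvg; near=> l.
by rewrite sumE -mulrBl Normc.normcM -rmorphB normc_real.
Unshelve. all: by end_near. Qed.

Lemma pcvg_linear (A : pol -> pol) d u r : linear A -> degree_nonincreasing _ _ A ->
  (forall l, (msize (u l) <= d)%N) -> (msize r <= d)%N ->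
  pcvg _ _ u r -> pcvg _ _ (fun l => A (u l)) (A r).
Proof.
move=> linA dA le_ud le_rd /(pcvg_cnorm _ _ _ _ _ le_ud le_rd) cv.
apply/(pcvg_cnorm _ _ _ _ d) => [l||].
- exact: leq_trans (dA _) _.
- exact: leq_trans (dA _) _.
have [C C0 HC] := linear_cnorm_bound _ _ _ d linA.
have cv0 : C * cnorm _ _ d (u l - r) @[l --> \oo] --> (0 : R).
  by rewrite -[X in _ --> X](mulr0 C); apply: cvgMr.
apply: (squeeze_cvgr _ (cvg_cst 0) cv0); near=> l.
rewrite cnorm_ge0 -linear_sub // HC //.
apply/msize_leP => m le_dm; rewrite mcoeffB.
by rewrite (msize_leP _ _ _ _ (le_ud l)) // (msize_leP _ _ _ _ le_rd) // subr0.
Unshelve. all: by end_near. Qed.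

Lemma gauss0 d p : (msize p <= d)%N -> gauss d 0 p = p.
Proof.
case: d => [|d] le_pd.
  by move: le_pd; rewrite leqn0 msize_poly_eq0 => /eqP ->; rewrite /gauss big_ord0.
rewrite /gauss big_ord_recl expr0 fact0 divr1 scale1r big1 ?addr0 // => j _.
by rewrite lift0 expr0n mul0r scale0r.
Qed.

Lemma op_exp_hermite (t : R) q :
  op_exp (fun p => t%:C *: hermite_op p) q =
  dilation (- t) (gauss (msize q) ((1 - expR (- t) ^+ 2) / 2)%:C q).
Proof.
(* With p = e^(Delta/2) q the powers of H are conjugated to those of - E: H^j q = e^(- Delta/2) (-
   E)^j p. *)
set d := msize q; pose p := gauss d 2^-1 q.
have le_pd : (msize p <= d)%N by apply: msize_gauss.
pose E := fun p : pol => - (t%:C *: euler p).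
have dE : degree_nonincreasing _ _ E.
  move=> p'; apply/msize_leP => m le_pm; rewrite mcoeffN mcoeffZ.
  by rewrite (msize_leP _ _ _ _ (msize_euler _ _ p')) // mulr0 oppr0.
have iterE j : iter j (fun p => t%:C *: hermite_op p) q =
    gauss d (- 2^-1) (iter j E p).
  elim: j => [|j IH]; first by rewrite gaussD // addNr gauss0.
  rewrite !iterS IH hermite_op_gauss; last exact: leq_trans (msize_iter _ _ _ _ _ dE) le_pd.
  by rewrite -(linear_scale _ _ _ _ _ (gauss_is_linear _ _)) scalerN.
apply: op_exp_eq.
have -> : expsum _ _ (fun p => t%:C *: hermite_op p) q =
    fun l => gauss d (- 2^-1) (expsum _ _ E p l).
  apply/funext => l; rewrite /expsum.
  rewrite (linear_combination _ _ _ _ _ _ _ (gauss_is_linear _ _)).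
  by apply: eq_bigr => j _; rewrite iterE.
(* Moving e^(- Delta/2) past the dilation changes its time to - e^(- 2t) / 2; adding the time 1/2
   contained in [p] gives (1 - e^(- 2t)) / 2. *)
have -> : dilation (- t) (gauss d ((1 - expR (- t) ^+ 2) / 2)%:C q) =
    gauss d (- 2^-1) (dilation (- t) p).
  rewrite gauss_dilation gaussD; last exact: leqnn.
  have -> : - 2^-1 * (expR (- t))%:C ^+ 2 + 2^-1 = ((1 - expR (- t) ^+ 2) / 2)%:C.
    by rewrite rmorphM rmorphB rmorph1 rmorphXn fmorphV rmorph_nat; field.
  reflexivity.
apply: (pcvg_linear _ d).
- exact: gauss_is_linear.
- by move=> p'; apply: msize_gauss.
- by move=> l; apply: leq_trans (msize_expsum _ _ _ _ _ dE) le_pd.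
- exact: leq_trans (msize_dilation _ _) le_pd.
- exact: pcvg_expsum_euler.
Qed.

End FlatHeat.

(** * Derivatives of polynomials along curves *)

Lemma mpoly_ring_ind n (K : comNzRingType) (Q : mpoly n K -> Prop) :
  (forall c, Q (mpolyC n c)) -> (forall i, Q (mpolyX K (mnm1 i))) ->
  (forall p q, Q p -> Q q -> Q (p + q)) -> (forall p q, Q p -> Q q -> Q (p * q)) ->
  forall p, Q p.
Proof.
move=> QC QX QD QM p; rewrite (mpolyE p).
apply: big_ind => [||m _]; [by rewrite -(mpolyC0 n K); apply: QC|exact: QD|].
rewrite -mul_mpolyC; apply: (QM) => //; rewrite mpolyXE_id.
have Q1 : Q 1 by rewrite -(mpolyC1 n K); apply: QC.
apply: big_ind => [||i _]; [exact: Q1|exact: QM|].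
by elim: (m i) => [|e IH]; rewrite ?expr0 // exprS; apply: QM.
Qed.

Section DerivativesAlongCurves.
Variable R : realType.

(** Both sides are additive and obey the Leibniz rule, so the chain rule needs checking on constants
    and variables only. *)
Lemma is_derive_meval n (P : mpoly n R) (c : 'I_n -> R -> R) (c' : 'I_n -> R) (h : R) :
  (forall i, is_derive h 1 (c i) (c' i)) ->
  is_derive h 1 (fun s => meval (c ^~ s) P)
    (\sum_(i < n) meval (c ^~ h) (mderiv i P) * c' i).
Proof.
move=> dc; elim/mpoly_ring_ind: P => [a|i|p q IHp IHq|p q IHp IHq].
- under eq_fun do rewrite mevalC.
  by rewrite big1 => [|i _]; [exact: is_derive_cst|rewrite mderivC meval0 mul0r].
- under eq_fun do rewrite mevalXU.
  rewrite (bigD1 i) //= big1 ?addr0 => [|j ne_ji].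
    rewrite mderivX mnm1E eqxx scale1r.
    rewrite (_ : mnm_sub _ _ = mnm0); last first.
      by apply/mnmP => j; rewrite mnmBE subnn mnm0E.
    by rewrite mpolyX0 meval1 mul1r.
  by rewrite mderivX mnm1E eq_sym (negbTE ne_ji) scale0r meval0 mul0r.
- under eq_fun do rewrite mevalD.
  apply: is_derive_eq.
  by rewrite -big_split; apply: eq_bigr => i _; rewrite /= mderivD mevalD mulrDl.
- under eq_fun do rewrite mevalM.
  apply: is_derive_eq.
  rewrite /= /GRing.scale /= !mulr_sumr -big_split; apply: eq_bigr => i _ /=.
  by rewrite mderivM mevalD !mevalM; ring.
Qed.

Lemma derive_along_line (V : normedModType R) (g : V -> R) x v :
  'D_v g x = 'D_1 (fun s : R => g (s *: v + x)) 0.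
Proof.
rewrite /derive; apply: (congr1 (fun f : R -> R => lim (f @ 0^'))); apply/funext => s /=.
by rewrite addr0 scale0r add0r [s *: 1]mulr1.
Qed.

End DerivativesAlongCurves.

(** * The radial projection onto the sphere and its differential *)

Section SpherePolynomials.
Variables (R : realType) (N : nat).
Implicit Types (x v : 'rV[R]_N).

Lemma enorm_sqr x : enorm x ^+ 2 = \sum_(j < N) x 0 j ^+ 2.
Proof. by rewrite sqr_sqrtr // sumr_ge0 // => j _; apply: sqr_ge0. Qed.

Lemma sphere_proj_sphere x : \sum_(j < N) x 0 j ^+ 2 != 0 -> sphere (sphere_proj x).
Proof.
move=> nz; rewrite /sphere /sphere_proj /=.
under eq_bigr do rewrite mxE exprMn.
rewrite -mulr_sumr -enorm_sqr exprMn sqr_sqrtr // exprVn mulfVK //.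
by rewrite enorm_sqr.
Qed.

Lemma sphere_proj_id x : sphere x -> (0 < N)%N -> sphere_proj x = x.
Proof.
move=> Sx N0; rewrite /sphere_proj /enorm Sx divff ?scale1r //.
by rewrite sqrtr_eq0 -ltNge ltr0n.
Qed.

Lemma is_derive_sqr_line x v :
  is_derive (0 : R) 1 (fun s => \sum_(i < N) (s *: v + x) 0 i ^+ 2)
    (2 * \sum_(i < N) x 0 i * v 0 i).
Proof.
rewrite (_ : (fun s => _) =
  \sum_(i < N) (fun s => (s * v 0 i + x 0 i) * (s * v 0 i + x 0 i))).
  apply: is_derive_eq.
  rewrite mulr_sumr; apply: eq_bigr => i _.
  by rewrite /GRing.scale /= mul0r add0r; ring.
by apply/funext => s; rewrite fct_sumE; apply: eq_bigr => i _; rewrite !mxE expr2.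
Qed.

(** Serves to keep nearby points of a line away from the origin, or inside an open ball. *)
Lemma cvg_sqr_line x v :
  \sum_(i < N) (s *: v + x) 0 i ^+ 2 @[s --> (0 : R)] --> \sum_(i < N) x 0 i ^+ 2.
Proof.
have [d _] := is_derive_sqr_line x v.
have <- : \sum_(i < N) ((0 : R) *: v + x) 0 i ^+ 2 = \sum_(i < N) x 0 i ^+ 2.
  by apply: eq_bigr => i _; rewrite scale0r add0r.
by move/derivable1_diffP/differentiable_continuous: d.
Qed.

(** At a point with |x|^2 = N the factor sqrt N / |x + s v| has value 1 and derivative - <x, v> / N,
    so the differential is the orthogonal projection v - (<x, v> / N) x onto the tangent space. *)
Lemma is_derive_sphere_proj x v j : sphere x -> (0 < N)%N ->
  is_derive (0 : R) 1 (fun s => sphere_proj (s *: v + x) 0 j)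
    (v 0 j - x 0 j / N%:R * \sum_(i < N) x 0 i * v 0 i).
Proof.
move=> Sx N0; have N0' : 0 < N%:R :> R by rewrite ltr0n.
pose sq (s : R) := \sum_(i < N) (s *: v + x) 0 i ^+ 2.
have dlin : is_derive (0 : R) 1 (fun s : R => s * v 0 j + x 0 j) (v 0 j).
  apply: is_derive_eq.
  by rewrite /GRing.scale /=; ring.
have sq0 : sq 0 = N%:R.
  by rewrite -Sx; apply: eq_bigr => i _; rewrite scale0r add0r.
have dsq : is_derive (0 : R) 1 sq (2 * \sum_(i < N) x 0 i * v 0 i).
  exact: is_derive_sqr_line.
pose r := Num.sqrt N%:R : R; have r0 : 0 < r by rewrite sqrtr_gt0.
have r2 : r ^+ 2 = N%:R by rewrite sqr_sqrtr // ltW.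
have dr : is_derive (0 : R) 1 (Num.sqrt \o sq)
    ((2 * r)^-1 * (2 * \sum_(i < N) x 0 i * v 0 i)).
  by apply: is_derive1_comp; rewrite sq0; apply: is_derive1_sqrt.
have rs0 : (Num.sqrt \o sq) 0 = r by rewrite /= sq0.
have rn0 : (Num.sqrt \o sq) 0 != 0 by rewrite rs0 gt_eqF.
have dV := is_deriveV rn0 dr.
rewrite (_ : (fun s => _) =
    (fun s : R => r * (((Num.sqrt \o sq) s)^-1 * (s * v 0 j + x 0 j)))); last first.
  by apply/funext => s; rewrite /sphere_proj !mxE mulrA.
apply: is_derive_eq.
rewrite rs0 -r2 /GRing.scale /= mul0r add0r.
by field; rewrite gt_eqF.
Qed.

End SpherePolynomials.

(** * The Laplace-Beltrami operator on real polynomials in n < N variables *)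

Section SphereLaplacian.
Variables (R : realType) (n N : nat) (lt_nN : (n < N)%N).
Implicit Types (P : mpoly n R) (x v : 'rV[R]_N).
Local Notation w := (widen_ord (ltnW lt_nN)).
Local Notation ev P x := (meval (fun i : 'I_n => (x : 'rV[R]_N) 0 (w i)) P).

Let N_gt0 : (0 < N)%N. Proof. exact: leq_ltn_trans lt_nN. Qed.
Let N_neq0 : N%:R != 0 :> R. Proof. by rewrite pnatr_eq0 -lt0n. Qed.

Lemma is_derive_meval_sphere_proj P x v : sphere x ->
  is_derive (0 : R) 1 (fun s => ev P (sphere_proj (s *: v + x)))
    (\sum_(i < n) ev (mderiv i P) x *
       (v 0 (w i) - x 0 (w i) / N%:R * \sum_(l < N) x 0 l * v 0 l)).
Proof.
move=> Sx.
have := @is_derive_meval R n P (fun i s => sphere_proj (s *: v + x) 0 (w i)) _ 0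
  (fun i => is_derive_sphere_proj _ _ x v (w i) Sx N_gt0).
by rewrite scale0r add0r sphere_proj_id.
Qed.

Lemma meval_euler P x : \sum_(i < n) x 0 (w i) * ev (mderiv i P) x = ev (euler P) x.
Proof. by rewrite raddf_sum; apply: eq_bigr => i _ /=; rewrite mevalM mevalXU. Qed.

Lemma dot_delta x j : \sum_(l < N) x 0 l * (delta_mx 0 j : 'rV[R]_N) 0 l = x 0 j.
Proof.
rewrite (bigD1 j) //= big1 ?addr0 => [|l ne_lj].
  by rewrite mxE !eqxx mulr1.
by rewrite mxE eqxx (negbTE ne_lj) mulr0.
Qed.

(** The j-th coordinate of the tangential part of the flat gradient, d_j P - (x_j / N) E P; the
    indicator makes d_j P vanish for the coordinates on which [P] does not depend. *)
Definition tangential_partial j P x : R :=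
  \sum_(i < n) ev (mderiv i P) x * (w i == j)%:R - x 0 j / N%:R * ev (euler P) x.

Lemma sphere_partial_meval P x j : sphere x ->
  sphere_partial j (fun y => ev P y) x = tangential_partial j P x.
Proof.
move=> Sx; rewrite /sphere_partial derive_along_line.
have [_ ->] := is_derive_meval_sphere_proj P x (delta_mx 0 j) Sx.
rewrite dot_delta /tangential_partial -meval_euler mulr_sumr -sumrB.
by apply: eq_bigr => i _; rewrite mxE eqxx; ring.
Qed.

(** The product rule, every factor being differentiated in the projected direction e_j - (x_j / N)
    x. *)
Lemma is_derive_tangential_partial P x j : sphere x ->
  is_derive (0 : R) 1
    (fun s => tangential_partial j P (sphere_proj (s *: delta_mx 0 j + x)))
    (\sum_(i < n) (\sum_(l < n) ev (mderiv l (mderiv i P)) x *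
        ((w l == j)%:R - x 0 (w l) / N%:R * x 0 j)) * (w i == j)%:R -
     ((1 - x 0 j / N%:R * x 0 j) / N%:R * ev (euler P) x +
      x 0 j / N%:R * \sum_(l < n) ev (mderiv l (euler P)) x *
        ((w l == j)%:R - x 0 (w l) / N%:R * x 0 j))).
Proof.
move=> Sx; pose v : 'rV[R]_N := delta_mx 0 j.
have vE l : v 0 l = (l == j)%:R by rewrite mxE eqxx.
have dP Q : is_derive (0 : R) 1 (fun s => ev Q (sphere_proj (s *: v + x)))
    (\sum_(l < n) ev (mderiv l Q) x * ((w l == j)%:R - x 0 (w l) / N%:R * x 0 j)).
  apply: is_derive_eq; first exact: is_derive_meval_sphere_proj.
  by apply: eq_bigr => l _; rewrite dot_delta vE.
have dx : is_derive (0 : R) 1 (fun s => sphere_proj (s *: v + x) 0 j)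
    (1 - x 0 j / N%:R * x 0 j).
  apply: is_derive_eq; first exact: is_derive_sphere_proj.
  by rewrite dot_delta vE eqxx.
apply: is_deriveB.
  rewrite (_ : (fun s => _) =
    \sum_(i < n) (fun s => (w i == j)%:R * ev (mderiv i P) (sphere_proj (s *: v + x)))).
    apply: is_derive_eq.
    by apply: eq_bigr => i _; rewrite [RHS]mulrC.
  by apply/funext => s; rewrite fct_sumE; apply: eq_bigr => i _; rewrite mulrC.
rewrite (_ : (fun s => _) = (fun s => N%:R^-1 *
  (sphere_proj (s *: v + x) 0 j * ev (euler P) (sphere_proj (s *: v + x))))).
  apply: is_derive_eq.
  rewrite scale0r add0r sphere_proj_id // /GRing.scale /=.
  by ring.
by apply/funext => s; rewrite mulrA [_^-1 * _]mulrC.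
Qed.

(** The formula for the gradient is available on the sphere only. For small s the point x + s e_j is
    not the origin, so its projection is on the sphere, and a derivative depends only on values near
    0. *)
Lemma sphere_partial_grad P x j : sphere x ->
  sphere_partial j (fun y => sphere_grad (fun z => ev P z) y 0 j) x =
  'D_1 (fun s : R => tangential_partial j P (sphere_proj (s *: delta_mx 0 j + x))) 0.
Proof.
move=> Sx; rewrite /sphere_partial derive_along_line.
apply: near_eq_derive.
have /cvgr_neq0 nz := cvg_sqr_line _ _ x (delta_mx 0 j).
near=> s; rewrite /= mxE sphere_partial_meval //.
apply: sphere_proj_sphere; near: s; apply: nz.
by rewrite Sx.
Unshelve. all: by end_near. Qed.

Lemma sum_delta (F : 'I_N -> R) i : \sum_(j < N) F j * (i == j)%:R = F i.
Proof.
rewrite (bigD1 i) //= eqxx mulr1 big1 ?addr0 // => j ne_ji.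
by rewrite eq_sym (negbTE ne_ji) mulr0.
Qed.

Lemma laplace_beltrami_meval P x : sphere x ->
  laplace_beltrami (fun y => ev P y) x =
  ev (laplacian P - ((N%:R - 2) / N%:R) *: euler P - N%:R^-1 *: euler (euler P)) x.
Proof.
move=> Sx; rewrite /laplace_beltrami /sphere_div.
under eq_bigr => j _.
  rewrite sphere_partial_grad //.
  have [_ ->] := is_derive_tangential_partial P x j Sx.
  over.
rewrite sumrB exchange_big big_split /=.
(* The tangential gradient of E P is orthogonal to x: summing x_j against the projection gives x_l -
   x_l |x|^2 / N = 0. *)
have -> : \sum_(j < N) x 0 j / N%:R * (\sum_(l < n) ev (mderiv l (euler P)) x *
    ((w l == j)%:R - x 0 (w l) / N%:R * x 0 j)) = 0.
  under eq_bigr do rewrite mulr_sumr.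
  rewrite exchange_big big1 // => l _ /=.
  rewrite (eq_bigr (fun j => ev (mderiv l (euler P)) x / N%:R *
    (x 0 j * (w l == j)%:R) - ev (mderiv l (euler P)) x * x 0 (w l) / N%:R ^+ 2 *
    (x 0 j ^+ 2))) => [|j _]; last by field.
  rewrite sumrB -!mulr_sumr Sx sum_delta.
  by field.
(* The trace of the projection onto the tangent space is N - 1. *)
have -> : \sum_(j < N) (1 - x 0 j / N%:R * x 0 j) / N%:R * ev (euler P) x =
    (N%:R - 1) / N%:R * ev (euler P) x.
  rewrite -!mulr_suml sumrB sumr_const card_ord.
  under [X in _ - X]eq_bigr do rewrite mulrAC -expr2.
  by rewrite -mulr_suml Sx divff.
(* The remaining part is the sum of d_i^2 P - (x_i / N) E d_i P. Since E d_i = d_i E - d_i, it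
   equals Delta P - (E^2 P - E P) / N, whose term E P / N turns the factor N - 1 into N - 2. *)
under eq_bigr => i _.
  rewrite (sum_delta (fun j => \sum_(l < n) ev (mderiv l (mderiv i P)) x *
      ((w l == j)%:R - x 0 (w l) / N%:R * x 0 j))).
  under eq_bigr => l _ do rewrite mulrBr.
  rewrite sumrB (eq_bigr (fun l => ev (mderiv l (mderiv i P)) x * (i == l)%:R)) => [|l _];
    last first.
    by rewrite -(inj_eq val_inj) /= eq_sym.
  rewrite (bigD1 i) //= eqxx mulr1 big1 ?addr0 => [|l ne_li]; last first.
    by rewrite eq_sym (negbTE ne_li) mulr0.
  rewrite (eq_bigr (fun l => x 0 (w l) * ev (mderiv l (mderiv i P)) x *
    (x 0 (w i) / N%:R))) => [|l _]; last by ring.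
  rewrite -mulr_suml meval_euler euler_deriv mevalB.
  over.
rewrite sumrB.
have -> : \sum_(i < n) (ev (mderiv i (euler P)) x - ev (mderiv i P) x) *
    (x 0 (w i) / N%:R) = (ev (euler (euler P)) x - ev (euler P) x) / N%:R.
  rewrite -!meval_euler -sumrB mulr_suml; apply: eq_bigr => i _.
  by ring.
have -> : \sum_(i < n) ev (mderiv i (mderiv i P)) x = ev (laplacian P) x.
  by rewrite raddf_sum.
by rewrite !mevalB !mevalZ; field.
Qed.

End SphereLaplacian.

(** * The polynomial form of the spherical Laplacian over an arbitrary field *)

Definition sphere_operator {n} {K : fieldType} (N : nat) (p : mpoly n K) : mpoly n K :=
  laplacian p - ((N%:R - 2) / N%:R) *: euler p - N%:R^-1 *: euler (euler p).

Lemma mcoeff_sphere_operator n (K : fieldType) N (p : mpoly n K) m :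
  mcoeff m (sphere_operator N p) = mcoeff m (laplacian p) -
    ((N%:R - 2) / N%:R) * (mcoeff m p *+ mdeg m) -
    N%:R^-1 * (mcoeff m p *+ mdeg m *+ mdeg m).
Proof. by rewrite !mcoeffB !mcoeffZ !mcoeff_euler. Qed.

Lemma msize_sphere_operator n (K : fieldType) N (p : mpoly n K) :
  (msize (sphere_operator N p) <= msize p)%N.
Proof.
apply/msize_leP => m le_pm; rewrite mcoeff_sphere_operator.
rewrite (msize_leP _ _ _ _ (msize_laplacian _ _ p)) //.
by rewrite (msize_leP _ _ _ _ (leqnn (msize p))) // !mul0rn !mulr0 !subr0.
Qed.

Lemma sphere_operator_is_linear n (K : fieldType) N :
  linear (@sphere_operator n K N).
Proof.
move=> c p q; rewrite /sphere_operator laplacian_is_linear !euler_is_linear.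
move: (laplacian p) (laplacian q) (euler p) (euler q) (euler (euler p)) (euler (euler q)).
move=> l l' e e' f f'; apply/mpolyP => m.
by rewrite !(mcoeffD, mcoeffN, mcoeffZ); ring.
Qed.

(** The coefficients of the operator come from the prime field, so it commutes with field
    embeddings; this carries the real computation over to complex coefficients. *)
Lemma sphere_operator_map n (K L : fieldType) (f : {rmorphism K -> L}) N (p : mpoly n K) :
  sphere_operator N (map_mpoly f p) = map_mpoly f (sphere_operator N p).
Proof.
have fE a b c : f (a - (N%:R - 2) / N%:R * b - N%:R^-1 * c) =
    f a - (N%:R - 2) / N%:R * f b - N%:R^-1 * f c.
  by rewrite !rmorphB !rmorphM fmorphV rmorphB !rmorph_nat.
apply/mpolyP => m; rewrite mcoeff_map_mpoly !mcoeff_sphere_operator.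
apply: etrans; last by symmetry; apply: fE.
rewrite mcoeff_map_mpoly !rmorphMn !mcoeff_laplacian rmorph_sum.
congr (_ - _ - _); apply: eq_bigr => i _.
by rewrite mcoeff_map_mpoly [RHS]rmorphMn.
Qed.

Lemma meval_map_mpoly n (K L : comNzRingType) (f : {rmorphism K -> L})
    (a : 'I_n -> K) (p : mpoly n K) :
  meval (fun i => f (a i)) (map_mpoly f p) = f (meval a p).
Proof.
elim/mpoly_ring_ind: p => [c|i|p q IHp IHq|p q IHp IHq].
- by rewrite map_mpolyC !mevalC.
- by rewrite map_mpolyX !mevalXU.
- by rewrite rmorphD /= !mevalD IHp IHq rmorphD.
- by rewrite rmorphM /= !mevalM IHp IHq rmorphM.
Qed.

(** * A polynomial in fewer than N variables is determined on the sphere *)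

Section Uniqueness.
Variable R : realType.

Lemma meval0_mcoeff n (P : mpoly n R) : meval (fun=> 0) P = mcoeff mnm0 P.
Proof.
rewrite [in LHS](mpolyE P) [in RHS](mpolyE P) !raddf_sum; apply: eq_bigr => m _ /=.
rewrite mevalZ mcoeffZ mevalX mcoeffX; congr (_ * _).
have [->|m0] := eqVneq m mnm0; first by rewrite big1 // => i _; rewrite mnm0E expr0.
have /existsP [i mi] : [exists i, m i != 0%N].
  apply: contraNT m0 => /existsPn m0; apply/eqP/mnmP => i; rewrite mnm0E.
  by apply/eqP; rewrite -[_ == _]negbK m0.
by rewrite (bigD1 i) //= expr0n (negbTE mi) mul0r.
Qed.

(* The polynomials vanishing on the ball are stable under partial derivatives,
   and have zero constant coefficient. *)
Lemma mpoly_eq0_ball n (P : mpoly n R) (e : R) : 0 < e ->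
  (forall a : 'rV[R]_n, \sum_(i < n) a 0 i ^+ 2 < e -> meval (fun i => a 0 i) P = 0) ->
  P = 0.
Proof.
move=> e0 P0; apply/mpolyP => m; rewrite mcoeff0.
elim: {m}(mdeg m) {-2}m (erefl (mdeg m)) P P0 => [|d IH] m dm P P0.
  move/eqP: dm; rewrite mdeg_eq0 => /eqP ->; rewrite -meval0_mcoeff.
  rewrite -[RHS](P0 0); first by apply: meval_eq => i; rewrite mxE.
  by rewrite big1 // => i _; rewrite mxE expr0n.
have /existsP [i mi] : [exists i, (0 < m i)%N].
  apply: contra_eqT dm => /existsPn m0; rewrite mdegE big1 // => i _.
  by apply/eqP; rewrite -leqn0 leqNgt m0.
have mE : mnm_add (mnm_sub m (mnm1 i)) (mnm1 i) = m by rewrite submK // lep1mP -lt0n.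
have dP (a : 'rV[R]_n) : \sum_(l < n) a 0 l ^+ 2 < e ->
    meval (fun l => a 0 l) (mderiv i P) = 0.
  move=> lt_ae; pose v : 'rV[R]_n := delta_mx 0 i.
  have dc (l : 'I_n) : is_derive (0 : R) 1 (fun s : R => (s *: v + a) 0 l) ((l == i)%:R).
    rewrite (_ : (fun s => _) = (fun s : R => s * (l == i)%:R + a 0 l)).
      by apply: is_derive_eq; rewrite /GRing.scale /=; ring.
    by apply/funext => s; rewrite !mxE eqxx.
  have [_ D] := is_derive_meval _ n P (fun l s => (s *: v + a) 0 l) _ 0 dc.
  have -> : meval (fun l => a 0 l) (mderiv i P) =
      'D_1 (fun s : R => meval (fun l => (s *: v + a) 0 l) P) 0.
    rewrite D (bigD1 i) //= eqxx mulr1 big1 ?addr0 => [|l ne_li].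
      by apply: meval_eq => l; rewrite scale0r add0r.
    by rewrite (negbTE ne_li) mulr0.
  rewrite (near_eq_derive _ (g := cst 0)) ?derive_cst //.
  have lt_near := cvgr_lt _ (cvg_sqr_line _ _ a v) _ lt_ae.
  by near=> s; rewrite /= P0 //; near: s; apply: lt_near.
have dm' : mdeg (mnm_sub m (mnm1 i)) = d.
  by apply/eqP; rewrite -eqSS -dm -mE mdegD mdeg1 addn1 addmK.
(* The coefficient at [m] of P is, up to a positive integer factor, the one at m - e_i of d_i P; the
   factor is invertible in characteristic zero. *)
have := IH _ dm' _ dP; rewrite mcoeff_deriv mE => /eqP.
by rewrite mulrn_eq0 /= => /eqP.
Unshelve. all: by end_near. Qed.

(** A point a of the ball |a|^2 < N lifts to the sphere: the first coordinate after those of a is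
    sqrt(N - |a|^2), and the later ones are 0. *)
Lemma mpoly_eq0_sphere n N (lt_nN : (n < N)%N) (P : mpoly n R) :
  (forall x : 'rV[R]_N, sphere x ->
    meval (fun i => x 0 (widen_ord (ltnW lt_nN) i)) P = 0) -> P = 0.
Proof.
move=> P0; apply: (mpoly_eq0_ball n P N%:R).
  by rewrite ltr0n (leq_ltn_trans _ lt_nN).
move=> a lt_aN; pose r := Num.sqrt (N%:R - \sum_(i < n) a 0 i ^+ 2).
pose g (j : nat) : R :=
  if insub j is Some i then a 0 i else if j == n then r else 0.
have gn (i : 'I_n) : g i = a 0 i by rewrite /g (valK i).
pose x : 'rV[R]_N := \row_j g j.
rewrite -[RHS](P0 x); first by apply: meval_eq => i; rewrite mxE -gn.
rewrite /sphere /=; under eq_bigr do rewrite mxE.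
rewrite -(big_mkord xpredT (fun j => g j ^+ 2)) (@big_cat_nat _ _ _ n) //=; last exact: ltnW.
have -> : \sum_(0 <= j < n) g j ^+ 2 = \sum_(i < n) a 0 i ^+ 2.
  by rewrite big_mkord; apply: eq_bigr => i _; rewrite gn.
rewrite big_ltn // {1}/g insubN ?ltnn // eqxx sqr_sqrtr ?subr_ge0 ?ltW //.
have -> : \sum_(n.+1 <= j < N) g j ^+ 2 = 0; last by rewrite addr0 subrKC.
rewrite big_nat_cond big1 // => j /andP[/andP[lt_nj _] _].
rewrite /g insubN; last by rewrite -leqNgt ltnW.
by rewrite gtn_eqF // expr0n.
Qed.

End Uniqueness.

(** * Real and imaginary parts of complex polynomials *)

Section ComplexPolynomials.
Variables (R : realType) (n : nat).
Local Open Scope complex_scope.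
Local Notation rc := (real_complex R).
Local Notation pol := (mpoly n R[i]).

Definition complex_mpoly (P Q : mpoly n R) : pol :=
  map_mpoly rc P + 'i *: map_mpoly rc Q.

Lemma mpoly_complexE (q : pol) : exists P Q : mpoly n R, q = complex_mpoly P Q.
Proof.
exists (\sum_(m <- msupp q) complex.Re (mcoeff m q) *: mpolyX R m).
exists (\sum_(m <- msupp q) complex.Im (mcoeff m q) *: mpolyX R m).
rewrite /complex_mpoly {1}(mpolyE q) !rmorph_sum scaler_sumr -big_split.
apply: eq_bigr => m _ /=.
by rewrite !map_mpolyZ !map_mpolyX scalerA -scalerDl -complexE.
Qed.

Lemma pol_fun_complexE N (lt_nN : (n < N)%N) (P Q : mpoly n R) (x : 'rV[R]_N) :
  pol_fun (complex_mpoly P Q) x =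
  meval (fun i => x 0 (widen_ord (ltnW lt_nN) i)) P +i*
  meval (fun i => x 0 (widen_ord (ltnW lt_nN) i)) Q.
Proof.
have -> p : pol_fun p x = meval (fun i => (x 0 (widen_ord (ltnW lt_nN) i))%:C) p.
  apply: meval_eq => i; rewrite (insubT (fun j => (j < N)%N) (ltn_trans (ltn_ord i) lt_nN)).
  by congr (x 0 _)%:C; apply: val_inj.
have ev_rc S : meval (fun i => (x 0 (widen_ord (ltnW lt_nN) i))%:C) (map_mpoly rc S) =
    (meval (fun i => x 0 (widen_ord (ltnW lt_nN) i)) S)%:C.
  exact: (meval_map_mpoly n R R[i] rc).
by rewrite /complex_mpoly mevalD mevalZ [RHS]complexE; congr (_ + _ * _); apply: ev_rc.
Qed.

Lemma sphere_operator_complexE N (P Q : mpoly n R) :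
  sphere_operator N (complex_mpoly P Q) =
  complex_mpoly (sphere_operator N P) (sphere_operator N Q).
Proof.
have lin := sphere_operator_is_linear n R[i] N; rewrite /complex_mpoly.
rewrite (linear_add _ _ _ _ _ lin) (linear_scale _ _ _ _ _ lin).
by congr (_ + _ *: _); apply: (sphere_operator_map n R R[i] rc).
Qed.

End ComplexPolynomials.

(** * Identification of the self-map induced by the spherical Laplacian *)

Section SphereLap.
Variables (R : realType) (n N : nat) (lt_nN : (n < N)%N).
Local Open Scope complex_scope.
Local Notation rc := (real_complex R).
Local Notation pol := (mpoly n R[i]).
Implicit Types (p q : pol).

Lemma pol_fun_inj p q :
  (forall x : 'rV[R]_N, sphere x -> pol_fun p x = pol_fun q x) -> p = q.
Proof.
have [P1 [P2 ->]] := mpoly_complexE R n p; have [Q1 [Q2 ->]] := mpoly_complexE R n q.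
move=> eq_pq.
suff [-> ->] : P1 = Q1 /\ P2 = Q2 by [].
have ev_eq (x : 'rV[R]_N) : sphere x ->
    meval (fun i => x 0 (widen_ord (ltnW lt_nN) i)) P1 =
    meval (fun i => x 0 (widen_ord (ltnW lt_nN) i)) Q1 /\
    meval (fun i => x 0 (widen_ord (ltnW lt_nN) i)) P2 =
    meval (fun i => x 0 (widen_ord (ltnW lt_nN) i)) Q2.
  move=> Sx.
  have := etrans (esym (pol_fun_complexE _ _ _ lt_nN P1 P2 x))
    (etrans (eq_pq x Sx) (pol_fun_complexE _ _ _ lt_nN Q1 Q2 x)).
  by case.
split; apply/eqP; rewrite -subr_eq0; apply/eqP; apply: (mpoly_eq0_sphere _ _ _ lt_nN) => x Sx.
  by rewrite mevalB (ev_eq x Sx).1 subrr.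
by rewrite mevalB (ev_eq x Sx).2 subrr.
Qed.

Lemma laplace_beltramiC_pol_fun q (x : 'rV[R]_N) : sphere x ->
  laplace_beltramiC (pol_fun q) x = pol_fun (sphere_operator N q) x.
Proof.
have [P [Q ->]] := mpoly_complexE R n q => Sx.
rewrite sphere_operator_complexE.
have LB S : laplace_beltrami (fun y : 'rV[R]_N =>
      meval (fun i => y 0 (widen_ord (ltnW lt_nN) i)) S) x =
    meval (fun i => x 0 (widen_ord (ltnW lt_nN) i)) (sphere_operator N S).
  exact: laplace_beltrami_meval.
have E := pol_fun_complexE _ _ _ lt_nN P Q.
apply: etrans (esym (pol_fun_complexE _ _ _ lt_nN _ _ x)).
congr (_ +i* _); apply: etrans (LB _); congr (laplace_beltrami _ x); apply/funext => y.
  exact: (congr1 (@complex.Re R) (E y)).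
exact: (congr1 (@complex.Im R) (E y)).
Qed.

(** The explicit operator satisfies the defining condition, and injectivity of restriction to the
    sphere leaves no other choice. *)
Lemma sphere_lapE q : sphere_lap N q = sphere_operator N q.
Proof.
rewrite /sphere_lap; case: xgetP => [p _ [_ pE]|/(_ (sphere_operator N q)) []].
  by apply: pol_fun_inj => x Sx; rewrite -pE // laplace_beltramiC_pol_fun.
split; first exact: msize_sphere_operator.
by move=> x Sx; apply: laplace_beltramiC_pol_fun.
Qed.

End SphereLap.

(** * The limit of the heat operators, and convergence in every norm *)

Section Limit.
Variables (R : realType) (n : nat).
Local Open Scope complex_scope.
Local Notation pol := (mpoly n R[i]).
Local Notation normc := (@Normc.normc R).
Implicit Types (p q r : pol).

(** Writing (N - 2) / N = 1 - 2 / N isolates H and leaves a perturbation of order 1/N. *)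
Lemma sphere_operatorE N p : (0 < N)%N ->
  sphere_operator N p = hermite_op p + N%:R^-1 *: (2 *: euler p - euler (euler p)).
Proof.
move=> N0; have N0' : N%:R != 0 :> R[i] by rewrite pnatr_eq0 -lt0n.
rewrite /sphere_operator hermite_opE.
move: (laplacian p) (euler p) (euler (euler p)) => l e f.
apply/mpolyP => m; rewrite !(mcoeffD, mcoeffN, mcoeffZ).
by field.
Qed.

Lemma heat_sphere_lap_cvg (T : R) q :
  pcvg R n (fun N => heat (sphere_lap N) T q) (heat (@hermite_op R n) T q).
Proof.
pose c : R[i] := (T / 2)%:C.
(* [B] is (T/2) (2 E - E^2), the coefficient of 1/N in (T/2) Delta_S. *)
pose B p := (c * 2) *: euler p + (- c) *: euler (euler p).
have linE : linear (@euler n R[i]) := @euler_is_linear n R[i].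
apply: (op_exp_perturbed_cvg _ _ _ _ B).
- exact: linear_scale_op (@hermite_op_is_linear R n).
- apply: linear_add_scale; first exact: linear_scale_op.
  by move=> a p p'; rewrite !linE.
- exact: degree_nonincreasing_scale (@msize_hermite_op R n).
- apply: degree_nonincreasing_add => p.
    exact: degree_nonincreasing_scale (@msize_euler n R[i]) p.
  exact: leq_trans (msize_euler _ _ _) (msize_euler _ _ _).
near=> N => p; have lt_nN : (n < N)%N by near: N; exists n.+1.
rewrite (sphere_lapE _ _ _ lt_nN) sphere_operatorE; last exact: leq_ltn_trans lt_nN.
rewrite /B; move: (hermite_op p) (euler p) (euler (euler p)) => h e f.
by apply/mpolyP => m; rewrite !(mcoeffD, mcoeffN, mcoeffZ); ring.
Unshelve. all: by end_near. Qed.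

Lemma msize_heat (L : pol -> pol) (T : R) q : linear L -> degree_nonincreasing R n L ->
  (msize (heat L T q) <= msize q)%N.
Proof.
move=> linL dL.
exact: (op_expP _ _ _ q (linear_scale_op _ _ L _ linL)
  (degree_nonincreasing_scale _ _ L (T / 2)%:C dL)).2.
Qed.

Lemma complexifyD p q : complexify (p + q) = complexify p + complexify q.
Proof. by apply/funext => a; apply: mevalD. Qed.

Lemma complexifyB p q : complexify (p - q) = complexify p - complexify q.
Proof. by apply/funext => a; apply: mevalB. Qed.

Lemma complexifyZ (c : R[i]) p : complexify (c *: p) = c *: complexify p.
Proof. by apply/funext => a; apply: mevalZ. Qed.

Lemma holpoly_complexify d p : (msize p <= d)%N -> holpoly d (complexify p).
Proof. by move=> le_pd; exists p. Qed.

Lemma norm_complexify_le d nu p : is_norm_on (@holpoly R n d) nu -> (msize p <= d)%N ->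
  nu (complexify p) <=
  \sum_(m : bmultinom n d) normc (mcoeff m p) * nu (complexify (mpolyX R[i] m)).
Proof.
case=> _ _ nuZ nuD le_pd; rewrite {1}(mpolywE le_pd).
(* The triangle inequality is applied one monomial at a time; the degree of the partial sums is
   carried along because the axioms of [nu] hold only inside [holpoly d]. *)
suff : forall s : seq (bmultinom n d),
  (msize (\sum_(m <- s) mcoeff m p *: mpolyX R[i] m) <= d)%N /\
  nu (complexify (\sum_(m <- s) mcoeff m p *: mpolyX R[i] m)) <=
  \sum_(m <- s) normc (mcoeff m p) * nu (complexify (mpolyX R[i] m)).
  by move=> /(_ (index_enum _)) [].
elim=> [|m s [le_sd le_s]].
  rewrite !big_nil msize0; split => //.
  by rewrite -(scale0r 0) complexifyZ nuZ ?Normc.normc0 ?mul0r //;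
    apply: holpoly_complexify; rewrite msize0.
have le_m : (msize (mcoeff m p *: mpolyX R[i] m) <= d)%N.
  by rewrite (leq_trans (msizeZ_le _ _)) // msizeX bmdeg.
rewrite !big_cons; split.
  apply/msize_leP => m' le_dm'; rewrite mcoeffD.
  by rewrite (msize_leP _ _ _ _ le_m) // (msize_leP _ _ _ _ le_sd) // addr0.
rewrite complexifyD (le_trans (nuD _ _ _ _)) //; try exact: holpoly_complexify.
rewrite complexifyZ nuZ ?lerD //; apply: holpoly_complexify.
by rewrite msizeX bmdeg.
Qed.

(** Every norm on the space is dominated by a weighted l^1 norm of the finitely many
    coefficients. *)
Lemma complexify_cvg d (u : nat -> pol) r nu :
  (\forall N \near \oo, (msize (u N) <= d)%N) -> (msize r <= d)%N ->
  is_norm_on (@holpoly R n d) nu -> pcvg R n u r ->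
  nu (complexify (u N) - complexify r) @[N --> \oo] --> (0 : R).
Proof.
move=> le_ud le_rd norm_nu cv.
have cv0 : \sum_(m : bmultinom n d)
    normc (mcoeff m (u N) - mcoeff m r) * nu (complexify (mpolyX R[i] m))
    @[N --> \oo] --> (0 : R).
  rewrite [X in _ --> X](_ : 0 = \sum_(m : bmultinom n d) (0 : R)); last by rewrite big1.
  apply: cvg_big => [|m _]; first exact: add_continuous.
  rewrite -[X in _ --> X](mul0r (nu (complexify (mpolyX R[i] m)))).
  by apply: cvgMl; exact: (cv (bmnm m)).
apply: (squeeze_cvgr _ (cvg_cst 0) cv0); near=> N.
have le_d : (msize (u N - r) <= d)%N.
  apply/msize_leP => m le_dm; rewrite mcoeffB (msize_leP _ _ _ _ le_rd) // subr0.
  by apply: (msize_leP _ _ (u N) d); rewrite //; near: N.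
rewrite -complexifyB; apply/andP; split.
  by have [nu0 _ _ _] := norm_nu; apply: nu0; apply: holpoly_complexify.
apply: le_trans (norm_complexify_le _ _ _ norm_nu le_d) _.
by apply: ler_sum => m _; rewrite mcoeffB.
Unshelve. all: by end_near. Qed.

End Limit.

(** * Identification of the limit and conclusion *)

Lemma heat_hermiteE (R : realType) (n : nat) (T : R) (q : mpoly n R[i]) :
  dilation (- (T / 2)) (heat (@lap R n) (1 - expR (- T)) q) =
  heat (@hermite_op R n) T q.
Proof.
apply: esym; apply: etrans (op_exp_hermite R n (T / 2) q) _.
congr (dilation _ _); rewrite -expRM_natl.
(* The Hermite semigroup runs for time t = T/2, so that e^(- 2t) is e^(- T). *)
have -> : 2 * - (T / 2) = - T by field.
by apply: esym; apply: op_exp_laplacian.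
Qed.

Theorem theorem6p21 (R : realType) (k : nat) (T : R) (q : mpoly k R[i])
    (T_gt0 : 0 < T) :
  let L := complexify
    (dilation (- (T / 2)) (heat (@lap R k) (1 - expR (- T)) q)) in
  cvg_in (@holpoly R k (msize q)) (fun N => CT T N q) L /\ L = BT T q.
Proof.
have limE : forall L, L = complexify (heat (@hermite_op R k) T q) ->
    cvg_in (@holpoly R k (msize q)) (fun N => CT T N q) L /\ L = BT T q.
  move=> L ->; split=> //.
  (* As soon as N > k the operator is the explicit linear one, which does not raise the degree, so
     the transforms of [q] lie in the space where the limit is taken. *)
  have le_near : \forall N \near \oo, (msize (heat (@sphere_lap R k N) T q) <= msize q)%N.
    near=> N; have lt_kN : (k < N)%N by near: N; exists k.+1.
    rewrite (_ : @sphere_lap R k N = sphere_operator N); last first.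
      by apply/funext => p; apply: sphere_lapE.
    apply: msize_heat; first exact: sphere_operator_is_linear.
    by move=> p; apply: msize_sphere_operator.
  have le_hermite : (msize (heat (@hermite_op R k) T q) <= msize q)%N.
    apply: msize_heat; first exact: hermite_op_is_linear.
    by move=> p; apply: msize_hermite_op.
  split.
  - near=> N; apply: holpoly_complexify; near: N; exact: le_near.
  - exact: holpoly_complexify.
  - by move=> nu norm_nu; apply: (complexify_cvg _ _ _ _ _ _ le_near) => //;
      apply: heat_sphere_lap_cvg.
by apply: limE; rewrite heat_hermiteE.
Unshelve. all: by end_near. Qed.
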